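(* Let $1<\alpha<2$, let $M\ge8$ be even, and let $\omega>0$. Let $\epsilon$ satisfy $$\frac{2^\alpha\mu\theta_0}{(M-2)^\alpha}<\epsilon\le\mu\theta_0,$$ and set $k_0=\big\lceil(\mu\theta_0/\epsilon)^{1/\alpha}\big\rceil+1$. Let $\nu=\max_j d_j$ be the largest diagonal entry of $D$. Then there exist matrices $\mathcal P_\omega,\mathcal Q_\omega\in\mathbb R^{2M\times2M}$ such that $$\widetilde{\mathcal F}_\omega^{-1}\mathcal R=\mathcal F_\omega^{-1}\mathcal R+\mathcal P_\omega+\mathcal Q_\omega .$$ These matrices satisfy $\operatorname{rank}(\mathcal P_\omega)=4k_0$, $$\|\mathcal P_\omega\|_2<\frac{2(\omega^2+\nu^2)M^{1/2}\mu}{\omega^2\sqrt{(\omega+1)^2+\big[\frac{2^{\alpha+1}\gamma\tau\theta}{(b-a)^\alpha}\big]^2}}\left[\frac{c_0}{2}-\frac{\theta}{(M-\frac12)^\alpha}\right],$$ and $$\|\mathcal Q_\omega\|_2<\frac{2(\omega^2+\nu^2)M^{1/2}\epsilon}{\omega^2\sqrt{(\omega+1)^2+\big[\frac{2^{\alpha+1}\gamma\tau\theta}{(b-a)^\alpha}\big]^2}} .$$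
   Context: Let $1<\alpha<2$, let $\gamma>0$ and $\tau>0$ be constants, and let $a<b$ be real numbers. Let $M$ be a positive integer, $h=(b-a)/(M+1)$ and $\mu=\gamma\tau/h^\alpha$. For $k\in\mathbb Z$ let $$c_k=(-1)^k\frac{\Gamma(\alpha+1)}{\Gamma(\alpha/2-k+1)\,\Gamma(\alpha/2+k+1)}.$$ Then $c_0>0$, $c_k=c_{-k}\le0$ for $k\ge1$, and $\sum_{k\ne0}|c_k|=c_0$. Let $T=\mu\,[c_{i-j}]_{i,j=1}^M$, which is symmetric Toeplitz and positive definite. For even $M$, let $C$ be the Strang circulant approximation of $T$: $C=\mu\,[s_{(i-j)\bmod M}]_{i,j=1}^M$, where - $s_k=c_k$ for $0\le k<M/2$, - $s_{M/2}=0$, - $s_k=c_{M-k}$ for $M/2<k<M$. Let $D=\operatorname{diag}(d_1,\dots,d_M)$ with $d_j\ge0$. Let $I$ denote an identity matrix of the appropriate size. Define $$\mathcal T=\begin{bmatrix} I & T\\ -T & I\end{bmatrix},\quad \mathcal C=\begin{bmatrix} I & C\\ -C & I\end{bmatrix},\quad \mathcal D=\begin{bmatrix} 0 & -D\\ D & 0\end{bmatrix},\quad \mathcal R=\begin{bmatrix} I & T-D\\ D-T & I\end{bmatrix}=\mathcal T+\mathcal D .$$ For $\omega>0$, the NASS preconditioner is $\mathcal F_\omega=\frac1{2\omega}(\omega I+\mathcal T)(\omega I+\mathcal D)$ and the CNAS preconditioner is $\widetilde{\mathcal F}_\omega=\frac1{2\omega}(\omega I+\mathcal C)(\omega I+\mathcal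 D)$. Finally, define the constants $$\theta=\frac{\big(1-\frac{1+\alpha}{5+\alpha/2}\big)^{5+\alpha/2}e^{1+\alpha}\Gamma(\alpha+1)\sin(\pi\alpha/2)}{\pi\alpha},\qquad \theta_0=\frac{\sqrt2\,e^{13/12}\Gamma(\alpha+1)\sin(\pi\alpha/2)}{\pi\alpha}.$$ *)

(* Defs.v *)
From HB Require Import structures.
From mathcomp Require Import all_boot all_order all_algebra.
From mathcomp Require Import all_classical all_reals all_analysis.
Set Implicit Arguments. Unset Strict Implicit. Unset Printing Implicit Defensive.
Import Order.TTheory GRing.Theory Num.Theory.
Local Open Scope ring_scope.
Local Open Scope classical_set_scope.

Section Defs.
Variable R : realType.

Definition Gamma_pos (x : R) : R :=
  Rintegral (@lebesgue_measure R) `]0%R, +oo[%classic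
    (fun t => t `^ (x - 1) * expR (- t)).

(* Extension to all reals by the functional equation
   Gamma(x) = Gamma(x+n) / (x (x+1) ... (x+n-1)), with x+n > 0
   (meaningful when x is not a nonpositive integer). *)
Definition Gamma (x : R) : R :=
  let n := if 0 < x then 0%N else (Num.truncn (- x)).+1 in
  Gamma_pos (x + n%:R) / \prod_(i < n) (x + i%:R).

Definition cc (alpha : R) (k : int) : R :=
  (-1) ^ k * Gamma (alpha + 1)
  / (Gamma (alpha / 2 - k%:~R + 1) * Gamma (alpha / 2 + k%:~R + 1)).

Definition hh (a b : R) (M : nat) : R := (b - a) / (M%:R + 1).
Definition mu_of (alpha gamma tau a b : R) (M : nat) : R :=
  gamma * tau / (hh a b M) `^ alpha.

Definition Tmat (alpha mu : R) (M : nat) : 'M[R]_M :=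
  \matrix_(i, j) (mu * cc alpha (i%:Z - j%:Z)).

Definition strang_s (alpha : R) (M k : nat) : R :=
  if (k < M./2)%N then cc alpha k%:Z
  else if k == M./2 then 0 else cc alpha (M - k)%N%:Z.

Definition Cmat (alpha mu : R) (M : nat) : 'M[R]_M :=
  \matrix_(i, j) (mu * strang_s alpha M ((i + M - j) %% M)).

Definition Dmat (M : nat) (d : 'I_M -> R) : 'M[R]_M := diag_mx (\row_j d j).

Definition bigT (M : nat) (A : 'M[R]_M) : 'M[R]_(M + M) :=
  block_mx 1%:M A (- A) 1%:M.
Definition bigD (M : nat) (D : 'M[R]_M) : 'M[R]_(M + M) :=
  block_mx 0 (- D) D 0.
Definition bigR (M : nat) (T D : 'M[R]_M) : 'M[R]_(M + M) :=
  block_mx 1%:M (T - D) (D - T) 1%:M.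

Definition precond (M : nat) (omega : R) (X Y : 'M[R]_(M + M)) : 'M[R]_(M + M) :=
  (2 * omega)^-1 *: ((omega%:M + X) *m (omega%:M + Y)).

Definition vnorm2 (n : nat) (x : 'cV[R]_n) : R := Num.sqrt (\sum_i x i 0 ^+ 2).
Definition opnorm2 (m n : nat) (A : 'M[R]_(m, n)) : R :=
  sup [set vnorm2 (A *m x) | x in [set x : 'cV[R]_n | vnorm2 x <= 1]].

Definition theta (alpha : R) : R :=
  (1 - (1 + alpha) / (5 + alpha / 2)) `^ (5 + alpha / 2) * expR (1 + alpha)
  * Gamma (alpha + 1) * sin (pi * alpha / 2) / (pi * alpha).
Definition theta0 (alpha : R) : R :=
  Num.sqrt 2 * expR (13 / 12) * Gamma (alpha + 1) * sin (pi * alpha / 2)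
  / (pi * alpha).

End Defs.

(* Main.v *)
(** With [b = alpha / 2], [t_k = - c_k] and [u_k = (k + b) t_k], the ratio
    [c_(k+1) / c_k = (k - b) / (k + 1 + b)] gives [u_k - u_(k+1) = alpha t_k], so
    every partial sum of the coefficients telescopes and the tails are
    [u_n / alpha].  Log-convexity of Gamma and the product
    [prod_k (1 - b^2 / k^2)] bound [u_n] between the quantities built from
    [theta] and [theta0].

    Write [K(A)] for the skew matrix [[0, A], [-A, 0]] with [A] symmetric, so
    that [|(c + K(A)) v|^2 = c^2 |v|^2 + |K(A) v|^2].  The difference of the
    two preconditioned matrices is
    [2 w (w + bigD)^-1 (w + bigC)^-1 K(T - C) (w + bigT)^-1 R].  [P] keeps the
    [k0] diagonals of [T - C] nearest to each of the two corners, where [T - C] is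
    triangular of full rank, and [Q] keeps the others.  Both norms follow from
    absolute row sums, from the row sums of [C], which bound it from below, and
    from the Cayley transform of [bigT], which is a contraction. *)

Require Import Defs.
From HB Require Import structures.
From mathcomp Require Import all_boot all_order all_algebra.
From mathcomp Require Import all_classical all_reals all_analysis.
From mathcomp Require Import measurable_realfun zify ring lra.
Set Implicit Arguments. Unset Strict Implicit. Unset Printing Implicit Defensive.
Import Order.TTheory GRing.Theory Num.Theory.
Import numFieldNormedType.Exports.
Local Open Scope ring_scope.
Local Open Scope classical_set_scope.

(** * The Gamma function *)

Section GammaIntegral.
Variable R : realType.
Implicit Types (x t s : R).

Definition gamma_integrand x t : R := t `^ (x - 1) * expR (- t).

Lemma gamma_integrand_ge0 x t : 0 <= gamma_integrand x t.
Proof. by rewrite mulr_ge0 ?powR_ge0 ?expR_ge0. Qed.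

Lemma continuous_gamma_integrand x t : 0 < t ->
  {for t, continuous (gamma_integrand x)}.
Proof.
move=> t0; apply: differentiable_continuous; apply/derivable1_diffP.
apply: derivableM; last by apply: ex_derive.
by apply: derivable_powR; rewrite in_itv/= t0.
Qed.

Lemma measurable_gamma_integrand x (D : set R) : measurable D ->
  measurable_fun D (fun t => (gamma_integrand x t)%:E).
Proof.
move=> mD; apply/measurable_EFinP; apply: measurable_funTS.
apply: measurable_funM.
  exact: measurable_powR.
by apply: measurableT_comp => //; exact: measurable_funN.
Qed.

Lemma within_continuous_gamma_integrand x (a b : R) : 0 < a ->
  {within `[a, b], continuous (gamma_integrand x)}.
Proof.
move=> a0; apply: continuous_in_subspaceT => t.
rewrite inE/= in_itv/= => /andP[at_ _].
exact: continuous_gamma_integrand (lt_le_trans a0 at_).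
Qed.

(** Integration by parts is done on a compact interval away from [0], where the integrand may be
    singular; the improper integral is reached later as a limit. *)
Lemma gamma_integral_parts x (a b : R) : 0 < x -> 0 < a -> a < b ->
  (\int[@lebesgue_measure R]_(t in `[a, b]) (gamma_integrand (x + 1) t)%:E
   = (a `^ x * expR (- a) - b `^ x * expR (- b))%:E
     + x%:E * \int[@lebesgue_measure R]_(t in `[a, b]) (gamma_integrand x t)%:E)%E.
Proof.
move=> x0 a0 ab.
have pos t : t \in `]a, b[%R -> 0 < t.
  by rewrite in_itv/= => /andP[+ _]; exact: lt_trans.
have b0 : 0 < b by exact: lt_trans ab.
have cpow (y t : R) : 0 < t -> {for t, continuous (fun t : R => t `^ y)}.
  move=> t0; apply: differentiable_continuous; apply/derivable1_diffP.
  by apply: derivable_powR; rewrite in_itv/= t0.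
have cexp : continuous (fun t : R => expR (- t)).
  move=> t; apply: differentiable_continuous; apply/derivable1_diffP.
  exact: ex_derive.
have := @integration_by_parts R (fun t => t `^ x) (fun t => - expR (- t))
  (fun t => x * t `^ (x - 1)) (fun t => expR (- t)) a b ab.
move=> /(_ _ _ _ _ _ _)/=.
have -> : (fun t => (t `^ x * expR (- t))%:E) = (fun t => (gamma_integrand (x + 1) t)%:E).
  by apply/funext => t; rewrite /gamma_integrand addrK.
move=> ->.
- have -> : (fun t => (x * t `^ (x - 1) * - expR (- t))%:E) =
            (fun t => ((- x)%:E * (gamma_integrand x t)%:E)%E).
    by apply/funext => t; rewrite -EFinM /gamma_integrand; congr EFin; ring.
  rewrite integralZl//; last first.
    apply: continuous_compact_integrable; first exact: segment_compact.
    exact: within_continuous_gamma_integrand.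
  rewrite EFinN mulNe oppeK; congr (_%:E + _)%E; ring.
- apply: continuous_in_subspaceT => t.
  rewrite inE/= in_itv/= => /andP[at_ _].
  apply: differentiable_continuous; apply/derivable1_diffP; apply: derivableM.
    exact: derivable_cst.
  by apply: derivable_powR; rewrite in_itv/= (lt_le_trans a0 at_).
- split.
  + by move=> t /pos t0; apply: derivable_powR; rewrite in_itv/= t0.
  + by apply/cvg_at_right_filter; exact: cpow.
  + by apply/cvg_at_left_filter; exact: cpow.
- by move=> t /pos t0; rewrite powR_derive1// in_itv/= t0.
- by apply: continuous_subspaceT.
- split.
  + by move=> t _; exact: ex_derive.
  + by apply/cvg_at_right_filter; apply: cvgN; exact: cexp.
  + by apply/cvg_at_left_filter; apply: cvgN; exact: cexp.
- by move=> t _; rewrite derive1E derive_val; ring.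
Qed.

(** The value is kept in [\bar R] so that the recurrence and log-convexity come before finiteness,
    which is deduced from them. *)
Definition gamma_eintegral x : \bar R :=
  (\int[@lebesgue_measure R]_(t in `]0%R, +oo[) (gamma_integrand x t)%:E)%E.

(** The shift to [n.+2] keeps the endpoints distinct from the start: [1/2 < 2] at [n = 0]. *)
Definition window (n : nat) : set R := `[(n.+2%:R)^-1, n.+2%:R].

(** Monotone convergence: the windows increase to the open half-line, and a window whose index
    exceeds [t + t^-1] contains [t]. *)
Lemma window_cvg x :
  (\int[@lebesgue_measure R]_(t in window n) (gamma_integrand x t)%:E
     @[n --> \oo] --> gamma_eintegral x)%E.
Proof.
have -> : gamma_eintegral x =
  (\int[@lebesgue_measure R]_(t in \bigcup_n window n) (gamma_integrand x t)%:E)%E.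
  rewrite /gamma_eintegral; congr integral; apply/seteqP; split => t /=.
    rewrite in_itv/= andbT => t0.
    exists (Num.truncn (t + t^-1)) => //; rewrite /window/= in_itv/=.
    have ti : 0 < t^-1 by rewrite invr_gt0.
    have := truncnS_gt (t + t^-1).
    set n := Num.truncn _; move=> tn.
    have h : t + t^-1 <= n.+2%:R.
      by rewrite (le_trans (ltW tn))// ler_nat.
    apply/andP; split; last by lra.
    by rewrite invf_ple ?posrE//; lra.
  rewrite /window => -[n _] /=; rewrite !in_itv/= andbT => /andP[h _].
  by apply: lt_le_trans h; rewrite invr_gt0.
apply: ge0_nondecreasing_set_cvg_integral.
- apply/nondecreasing_seqP => n; rewrite /window subsetEset => t /=.
  rewrite !in_itv/= => /andP[h1 h2]; apply/andP; split.
    by apply: le_trans h1; rewrite lef_pV2 ?posrE// ler_nat.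
  by apply: (le_trans h2); rewrite ler_nat.
- by move=> n; exact: measurable_itv.
- by move=> n; apply: measurable_gamma_integrand; exact: measurable_itv.
- by move=> n t _; rewrite lee_fin gamma_integrand_ge0.
Qed.

(** With an integer [N >= x], one term of the exponential series, [y^(N+1) / (N+1)! <= exp y],
    leaves a bound of order [1/n]. *)
Lemma powR_expRN_cvg0 x : 0 < x ->
  ((n.+2%:R : R) `^ x * expR (- n.+2%:R)) @[n --> \oo] --> (0 : R).
Proof.
move=> x0; pose N := (Num.truncn x).+1.
have xN : x <= N%:R by exact: ltW (truncnS_gt x).
apply: (@squeeze_cvgr _ _ _ _ (fun=> 0) (fun n => (N.+1`!)%:R * n.+1%:R^-1)).
- apply: nearW => n; apply/andP; split.
    by rewrite mulr_ge0 ?powR_ge0 ?expR_ge0.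
  have h := @expR_ge1Dxn R n.+2%:R N (ler0n _ _).
  rewrite expRN ler_pdivrMr ?expR_gt0//.
  apply: (@le_trans _ _ (n.+2%:R ^+ N)).
    by rewrite -powR_mulrn//; apply: ler_powR => //; rewrite ler1n.
  apply: (@le_trans _ _ ((N.+1)`!%:R * n.+1%:R^-1 * (n.+2%:R ^+ N.+1 / N.+1`!%:R))); last first.
    apply: ler_wpM2l; last by lra.
    by rewrite mulr_ge0.
  have F0 : (N.+1`!%:R : R) != 0 by rewrite pnatr_eq0 -lt0n fact_gt0.
  have -> : (N.+1)`!%:R * n.+1%:R^-1 * (n.+2%:R ^+ N.+1 / N.+1`!%:R)
          = n.+2%:R ^+ N * (n.+2%:R / n.+1%:R) :> R.
    by rewrite exprSr; field; rewrite F0 addrC natr1 pnatr_eq0.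
  by rewrite ler_peMr ?exprn_ge0// ler_pdivlMr// mul1r ler_nat.
- exact: cvg_cst.
- rewrite -[X in _ --> X](mulr0 (N.+1)`!%:R); apply: cvgMr.
  exact: cvg_harmonic.
Qed.

(** Limit of [gamma_integral_parts] along the windows; both boundary terms tend to [0], the left one
    because [x > 0]. *)
Lemma gamma_eintegralD1 x : 0 < x ->
  (gamma_eintegral (x + 1) = x%:E * gamma_eintegral x)%E.
Proof.
move=> x0.
have h1 := window_cvg (x := x + 1).
have h2 := window_cvg (x := x).
have h3 : (fun n : nat => (n.+2%:R^-1 `^ x * expR (- (n.+2%:R^-1))
        - n.+2%:R `^ x * expR (- n.+2%:R) : R)) @ \oo --> (0 : R).
  rewrite -(subr0 0); apply: cvgB; last exact: powR_expRN_cvg0.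
  apply: (@squeeze_cvgr _ _ _ _ (fun=> 0) (fun n => n.+2%:R^-1 `^ x)).
  - apply: nearW => n; rewrite mulr_ge0 ?powR_ge0 ?expR_ge0//=.
    by rewrite ler_piMr ?powR_ge0// -[leRHS]expR0 ler_expR oppr_le0 invr_ge0.
  - exact: cvg_cst.
  - have := @powR_cvg0 R x x0; move/cvg_at_rightP; apply; split.
      by move=> n; rewrite invr_gt0.
    by have := @cvg_harmonic R; rewrite -cvg_shiftS.
have : (\int[@lebesgue_measure R]_(t in window n) (gamma_integrand (x + 1) t)%:E
     @[n --> \oo] --> (0%:E + x%:E * gamma_eintegral x))%E.
  under eq_cvg => n.
    rewrite gamma_integral_parts//; last first.
      by rewrite invf_plt ?posrE// (@lt_le_trans _ _ 1) ?invf_lt1 ?ltr1n ?ler1n.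
    over.
  apply: cvgeD => //.
  - by apply/fine_cvgP; split; [exact: nearW|].
  - by apply: cvgeZl => //.
by move/(cvg_unique _ h1) => /(_ (@ereal_hausdorff R)) ->; rewrite add0e.
Qed.
Lemma gamma_eintegral_ge0 x : (0 <= gamma_eintegral x)%E.
Proof.
by apply: integral_ge0 => t _; rewrite lee_fin gamma_integrand_ge0.
Qed.

(** The right-hand side is the tangent line at [s] of the concave power with exponent [d]. With
    [t = s e^u] the claim becomes [e^(u d) <= 1 - d + d e^u], which follows from [1 + y <= e^y] at
    [y = - u d] and at [y = u - u d]. *)
Lemma powR_le_tangent (s t d : R) : 0 < s -> 0 < t -> 0 <= d <= 1 ->
  t `^ d <= s `^ d * (1 - d) + d * s `^ d / s * t.
Proof.
move=> s0 t0 /andP[d0 d1].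
have [u uE] : exists u, t = s * expR u.
  by exists (ln (t / s)); rewrite lnK ?posrE ?divr_gt0// mulrC divfK// gt_eqF.
rewrite uE powRM ?expR_ge0 ?(ltW s0)//.
have -> : s `^ d * (1 - d) + d * s `^ d / s * (s * expR u)
  = s `^ d * ((1 - d) + d * expR u) by field; rewrite gt_eqF.
rewrite ler_pM2l ?powR_gt0// -expRM.
have h1 := expR_ge1Dx (- (u * d)).
have h2 := expR_ge1Dx (u - u * d).
have -> : expR u = expR (u * d) * expR (u - u * d).
  by rewrite -expRD; congr expR; ring.
have h3 : 1 = expR (u * d) * expR (- (u * d)) by rewrite -expRD subrr expR0.
rewrite [in X in _ <= X - d + _]h3 [X in _ <= _ - X + _](_ : d = d * (expR (u * d) * expR (- (u * d)))); last by rewrite -h3 mulr1.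
have e0 := expR_gt0 (u * d).
have -> : expR (u * d) * expR (- (u * d)) - d * (expR (u * d) * expR (- (u * d)))
 + d * (expR (u * d) * expR (u - u * d)) =
 expR (u * d) * ((1 - d) * expR (- (u * d)) + d * expR (u - u * d)) by ring.
rewrite ler_peMr ?(ltW e0)//.
have h4 : (1 - d) * (1 - u * d) <= (1 - d) * expR (- (u * d)).
  by rewrite ler_wpM2l// subr_ge0.
have h5 : d * (1 + (u - u * d)) <= d * expR (u - u * d) by rewrite ler_wpM2l.
apply: le_trans (lerD h4 h5).
by rewrite le_eqVlt; apply/orP; left; apply/eqP; ring.
Qed.

(** The tangent inequality is integrated against [t^(s-1) e^(-t)]. The linear term produces
    [Gamma(s + 1) = s Gamma(s)], and the weights [1 - d] and [d] then add up to one. *)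
Lemma gamma_eintegral_log_convex (s d : R) : 0 < s -> 0 <= d <= 1 ->
  (gamma_eintegral (s + d) <= (s `^ d)%:E * gamma_eintegral s)%E.
Proof.
move=> s0 d01; have /andP[d0 d1] := d01.
have c1 : 0 <= s `^ d * (1 - d) by rewrite mulr_ge0 ?powR_ge0 ?subr_ge0.
have c2 : 0 <= d * s `^ d / s by rewrite divr_ge0 ?mulr_ge0 ?powR_ge0 ?(ltW s0).
apply: (@le_trans _ _ ((s `^ d * (1 - d))%:E * gamma_eintegral s + (d * s `^ d / s)%:E * gamma_eintegral (s + 1))%E); last first.
  rewrite gamma_eintegralD1// muleA -EFinM divfK ?gt_eqF//.
  rewrite -ge0_muleDl ?lee_fin//; last by rewrite mulr_ge0 ?powR_ge0.
  rewrite -EFinD (_ : _ + _ = s `^ d)//; ring.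
rewrite /gamma_eintegral -!ge0_integralZl//; last first.
- by move=> t _; rewrite lee_fin gamma_integrand_ge0.
- exact: measurable_gamma_integrand.
- by move=> t _; rewrite lee_fin gamma_integrand_ge0.
- exact: measurable_gamma_integrand.
have g_ge0 (k y t : R) : 0 <= k -> (0 <= k%:E * (gamma_integrand y t)%:E)%E.
  by move=> k0; rewrite -EFinM lee_fin; apply: mulr_ge0 => //; exact: gamma_integrand_ge0.
rewrite -ge0_integralD//; last first.
- by apply: measurable_funeM; exact: measurable_gamma_integrand.
- by move=> t _; exact: g_ge0.
- by apply: measurable_funeM; exact: measurable_gamma_integrand.
- by move=> t _; exact: g_ge0.
apply: ge0_le_integral => //.
- by move=> t _; rewrite lee_fin gamma_integrand_ge0.
- exact: measurable_gamma_integrand.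
- apply: emeasurable_funD; apply: measurable_funeM;
    exact: measurable_gamma_integrand.
move=> t; rewrite /= in_itv/= andbT => t0.
rewrite -!EFinM -EFinD lee_fin /gamma_integrand addrK.
have h := powR_le_tangent s0 t0 d01.
have -> : s + d - 1 = (s - 1) + d by ring.
have tn : t != 0 by rewrite gt_eqF.
rewrite powRD ?tn ?implybT//.
have -> : t `^ s = t `^ (s - 1) * t.
  by rewrite -[X in _ * X](powRr1 (ltW t0)) -powRD ?tn ?implybT// subrK.
have k0 : 0 <= t `^ (s - 1) * expR (- t) by rewrite mulr_ge0 ?powR_ge0 ?expR_ge0.
rewrite [leLHS](_ : _ = t `^ (s - 1) * expR (- t) * t `^ d); last by ring.
rewrite [leRHS](_ : _ = t `^ (s - 1) * expR (- t) * (s `^ d * (1 - d) + d * s `^ d / s * t)); last by ring.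
by rewrite ler_wpM2l.
Qed.

Lemma gamma_eintegral1 : gamma_eintegral (1 : R) = 1%E.
Proof.
rewrite /gamma_eintegral integral_itv_obnd_cbnd; last first.
  exact: measurable_gamma_integrand.
have -> : (fun t : R => (gamma_integrand 1 t)%:E) = (fun t => (expR (- t))%:E).
  by apply/funext => t; rewrite /gamma_integrand subrr powRr0 mul1r.
have cexp : continuous (fun t : R => expR (- t)).
  move=> t; apply: differentiable_continuous; apply/derivable1_diffP.
  exact: ex_derive.
rewrite (@ge0_continuous_FTC2y R _ (fun t => - expR (- t)) _ 0)//.
- by rewrite oppr0 expR0 EFinN oppeK add0e.
- exact: continuous_subspaceT.
- by rewrite -oppr0; apply: cvgN; exact: cvgr_expR.
- by apply: cvgN; apply/cvg_at_right_filter; exact: cexp.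
- by move=> t _; rewrite derive1E derive_val; ring.
Qed.

(** On []0, 1]] log-convexity at [s = 1] gives [x Gamma(x) = Gamma(1 + x) <= 1]; the recurrence
    carries finiteness to larger arguments. *)
Lemma gamma_eintegral_fin_num x : 0 < x -> (gamma_eintegral x) \is a fin_num.
Proof.
have [n] : exists n : nat, x <= n.+1%:R.
  by exists (Num.truncn x); exact: ltW (truncnS_gt x).
elim: n x => [|n IHn] x xn x0.
  have x1 : 0 <= x <= 1 by rewrite xn ltW.
  have := gamma_eintegral_log_convex (@ltr01 R) x1.
  rewrite powR1 mul1e addrC gamma_eintegralD1// gamma_eintegral1 => h.
  have G0 := gamma_eintegral_ge0 x.
  move: h G0; case: (gamma_eintegral x) => [r| |]//= h _.
  by move: h; rewrite gt0_muley ?lte_fin// leye_eq.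
have [x1|x1] := leP x 1.
  by apply: IHn => //; rewrite (le_trans x1)// ler1n.
have -> : x = (x - 1) + 1 by rewrite subrK.
rewrite gamma_eintegralD1 ?subr_gt0//; apply: fin_numM => //.
by apply: IHn; rewrite ?subr_gt0// lerBlDr natr1.
Qed.

Lemma Gamma_posE x : 0 < x -> (Gamma_pos x)%:E = gamma_eintegral x.
Proof. by move=> x0; rewrite -[RHS]fineK ?gamma_eintegral_fin_num. Qed.

Lemma Gamma_posD1 x : 0 < x -> Gamma_pos (x + 1) = x * Gamma_pos x.
Proof.
move=> x0; apply: EFin_inj; rewrite EFinM !Gamma_posE ?addr_gt0//.
exact: gamma_eintegralD1.
Qed.

Lemma Gamma_pos1 : Gamma_pos (1 : R) = 1.
Proof. by apply: EFin_inj; rewrite Gamma_posE// gamma_eintegral1. Qed.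

Lemma Gamma_pos_nat n : Gamma_pos (n.+1%:R : R) = n`!%:R.
Proof.
elim: n => [|n IHn]; first exact: Gamma_pos1.
by rewrite -natr1 Gamma_posD1 ?ltr0n// IHn factS natrM.
Qed.

Lemma Gamma_pos_log_convex (s d : R) : 0 < s -> 0 <= d <= 1 ->
  Gamma_pos (s + d) <= s `^ d * Gamma_pos s.
Proof.
move=> s0 d01; have /andP[d0 _] := d01.
rewrite -lee_fin EFinM !Gamma_posE// ?ltr_wpDr//.
exact: gamma_eintegral_log_convex.
Qed.

(** Log-convexity from [x] up to the next integer [n + 1] bounds [n! > 0] by a positive multiple of
    [Gamma(x)]. *)
Lemma Gamma_pos_gt0 x : 0 < x -> 0 < Gamma_pos x.
Proof.
move=> x0; set n := Num.truncn x.
have /andP[xn nx] := truncn_itv (ltW x0).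
have d01 : 0 <= n.+1%:R - x <= 1.
  by rewrite subr_ge0 ltW// lerBlDr -nat1r lerD2l.
have := Gamma_pos_log_convex x0 d01.
rewrite addrC subrK Gamma_pos_nat.
have n0 : 0 < n`!%:R :> R by rewrite ltr0n fact_gt0.
by move/(lt_le_trans n0); rewrite pmulr_rgt0 ?powR_gt0.
Qed.
End GammaIntegral.

(** * The coefficients and their tails *)

Section Coefficients.
Variable R : realType.
Implicit Types (x alpha : R).

Lemma Gamma_gt0E x : 0 < x -> Gamma x = Gamma_pos x.
Proof. by move=> x0; rewrite /Gamma x0 big_ord0 divr1 addr0. Qed.

Lemma Gamma_subn (b : R) (k : nat) : 0 < b < 1 ->
  Gamma (b - k%:R) = Gamma_pos b / \prod_(i < k) (b - k%:R + i%:R).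
Proof.
move=> /andP[b0 b1]; case: k => [|k].
  by rewrite subr0 Gamma_gt0E// big_ord0 divr1.
have neg : b - k.+1%:R < 0 by rewrite subr_lt0 (lt_le_trans b1)// ler1n.
rewrite /Gamma ltNge (ltW neg)/=.
(* The number [k + 1 - b] lies strictly between [k] and [k + 1], so [Gamma] shifts its argument by
   exactly [k + 1] and lands on [b]. *)
have -> : Num.truncn (- (b - k.+1%:R)) = k.
  have k0 : (0 : R) <= k%:R by [].
  apply/eqP; rewrite truncn_eq -natr1; lra.
by rewrite subrK.
Qed.

(** The functional equation at the negative non-integers occurring in [cc]: the two denominators
    differ by their first factor. *)
Lemma GammaS_subn (b : R) (k : nat) : 0 < b < 1 ->
  Gamma (b - k%:R) = Gamma (b - k.+1%:R) * (b - k.+1%:R).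
Proof.
move=> b01; have /andP[b0 b1] := b01.
have nz (i : nat) : b - k.+1%:R + i%:R != 0.
  apply/eqP => h.
  have : i%:R < k.+1%:R :> R by lra.
  have : k.+1%:R < i.+1%:R :> R by rewrite -(natr1 i); lra.
  by rewrite !ltr_nat ltnS => /leq_ltn_trans /[apply]; rewrite ltnn.
rewrite !Gamma_subn// big_ord_recl/= addr0.
have -> : \prod_(i < k) (b - k.+1%:R + (bump 0 i)%:R)
        = \prod_(i < k) (b - k%:R + i%:R).
  by apply: eq_bigr => i _; rewrite /bump add1n -(natr1 i) -(natr1 k); ring.
rewrite invfM mulrA mulrAC mulfVK//.
by have := nz 0%N; rewrite addr0.
Qed.

Lemma ccN alpha (k : int) : cc alpha (- k) = cc alpha k.
Proof.
rewrite /cc -exprz_inv invrN1 mulrNz opprK; congr (_ / _).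
by rewrite mulrC.
Qed.

Lemma cc0E alpha : 0 < alpha -> cc alpha 0 =
  Gamma_pos (alpha + 1) / Gamma_pos (alpha / 2 + 1) ^+ 2.
Proof.
move=> a0; rewrite /cc expr0z mul1r subr0 addr0 -expr2 !Gamma_gt0E//; lra.
Qed.

Lemma cc_abs alpha (k : int) : cc alpha k = cc alpha `|k|%N%:Z.
Proof. by case: (intP k) => // n; rewrite ccN abszN. Qed.

Lemma ccS alpha (k : nat) : 0 < alpha < 2 ->
  cc alpha k.+1%:Z =
  cc alpha k%:Z * ((k%:R - alpha / 2) / (k.+1%:R + alpha / 2)).
Proof.
move=> /andP[a0 a2]; set b := alpha / 2.
have b01 : 0 < b < 1 by rewrite /b; lra.
have /andP[b0 b1] := b01.
rewrite /cc -/b -!exprnP -!pmulrn exprS mulN1r.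
have -> : b + k.+1%:R + 1 = (b + k%:R + 1) + 1 by rewrite -natr1; ring.
have p1 : 0 < b + k%:R + 1 by rewrite ltr_wpDl// addr_ge0// ltW.
rewrite [Gamma (b + k%:R + 1 + 1)]Gamma_gt0E ?(addr_gt0 p1)//.
rewrite Gamma_posD1// -Gamma_gt0E//.
have -> : b - k.+1%:R + 1 = b - k%:R by rewrite -natr1; ring.
have -> : Gamma (b - k%:R + 1) = Gamma (b - k%:R) * (b - k%:R).
  case: k {p1} => [|k].
    by rewrite subr0 !Gamma_gt0E ?addr_gt0// Gamma_posD1// mulrC.
  have -> : b - k.+1%:R + 1 = b - k%:R by rewrite -natr1; ring.
  exact: GammaS_subn.
have nz : b - k%:R != 0.
  case: k {p1} => [|k]; first by rewrite subr0 gt_eqF.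
  by rewrite lt_eqF// subr_lt0 (lt_le_trans b1)// ler1n.
rewrite -natr1.
move: (Gamma (b - k%:R)) (Gamma (b + k%:R + 1)) => g h.
rewrite !invfM; move: (g^-1) (h^-1) => gi hi.
by field; rewrite nz andbT gt_eqF//; lra.
Qed.

Definition tcoef alpha (k : nat) : R := - cc alpha k%:Z.

Definition ucoef alpha (k : nat) : R := (k%:R + alpha / 2) * tcoef alpha k.

Lemma cc0_gt0 alpha : 0 < alpha -> 0 < cc alpha 0.
Proof.
move=> a0; rewrite cc0E// divr_gt0 ?exprn_gt0 ?Gamma_pos_gt0//; lra.
Qed.

(** This is the source of [c_0 / 2] in the final bound: it is [u_1 / alpha], the upper end of the
    telescoping sums. *)
Lemma ucoef1 alpha : 0 < alpha < 2 -> ucoef alpha 1 = alpha / 2 * cc alpha 0.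
Proof.
move=> a02; rewrite /ucoef /tcoef ccS//.
have /andP[a0 _] := a02.
by field; rewrite gt_eqF//; lra.
Qed.

Lemma ucoefS alpha (k : nat) : 0 < alpha < 2 -> (0 < k)%N ->
  ucoef alpha k.+1 =
  ucoef alpha k * ((k%:R - alpha / 2) / (k%:R + alpha / 2)).
Proof.
move=> a02 k0; rewrite /ucoef /tcoef ccS// -natr1.
have /andP[a0 _] := a02.
have kp : (0 : R) <= k%:R by [].
by field; rewrite !gt_eqF//; lra.
Qed.

Lemma ucoef_sub alpha (k : nat) : 0 < alpha < 2 ->
  ucoef alpha k - ucoef alpha k.+1 = alpha * tcoef alpha k.
Proof.
move=> a02; rewrite /ucoef /tcoef ccS// -natr1.
have /andP[a0 _] := a02.
have kp : (0 : R) <= k%:R by [].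
by field; rewrite !gt_eqF//; lra.
Qed.

(** The ratio [(k - b) / (k + 1 + b)] is negative at [k = 0] only, so the sign changes exactly once,
    starting from [c_0 > 0]. *)
Lemma tcoef_gt0 alpha (k : nat) : 0 < alpha < 2 -> (0 < k)%N ->
  0 < tcoef alpha k.
Proof.
move=> a02; have /andP[a0 a2] := a02.
case: k => // k _; elim: k => [|k IHk]; rewrite /tcoef ccS// -mulNr.
  rewrite mulNr -mulrN mulr_gt0 ?cc0_gt0//.
  by rewrite sub0r mulNr opprK divr_gt0//; lra.
rewrite mulr_gt0//; have kp : (0 : R) <= k%:R by [].
have [e1 e2] := (@natr1 R k, @natr1 R k.+1).
by apply: divr_gt0; lra.
Qed.

Lemma tcoef_decr alpha (j k : nat) : 0 < alpha < 2 -> (0 < j < k)%N ->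
  tcoef alpha k < tcoef alpha j.
Proof.
move=> a02 /andP[j0]; have /andP[a0 a2] := a02.
elim: k => // k IHk; rewrite ltnS leq_eqVlt.
have step i : (0 < i)%N -> tcoef alpha i.+1 < tcoef alpha i.
  move=> i0; rewrite [in ltLHS]/tcoef ccS// -mulNr.
  rewrite gtr_pMr ?tcoef_gt0//; have ip : (0 : R) <= i%:R by [].
  by have e1 := @natr1 R i; rewrite ltr_pdivrMr; lra.
move=> /predU1P[<-|jk]; first exact: step.
by apply: lt_trans (IHk jk); apply: step; apply: ltn_trans jk.
Qed.

Lemma sum_tcoef alpha (m n : nat) : 0 < alpha < 2 -> (m <= n)%N ->
  \sum_(m <= k < n) tcoef alpha k = (ucoef alpha m - ucoef alpha n) / alpha.
Proof.
move=> a02 mn; have /andP[a0 _] := a02.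
rewrite (@telescope_sumr_eq _ _ _ (fun k => - ucoef alpha k / alpha))//.
  by field; rewrite gt_eqF.
have an : alpha != 0 by rewrite gt_eqF.
move=> k _; apply: (mulfI an).
by rewrite -ucoef_sub//; field.
Qed.

Lemma ucoef_gt0 alpha (k : nat) : 0 < alpha < 2 -> (0 < k)%N -> 0 < ucoef alpha k.
Proof.
move=> a02 k0; have /andP[a0 _] := a02.
rewrite mulr_gt0 ?tcoef_gt0//; have kp : (0 : R) <= k%:R by [].
lra.
Qed.

(** Each ratio [(k - b) / (k + b)] is written [(k^2 - b^2) / (k + b)^2], and the squared Gamma value
    absorbs the denominators. *)
Lemma ucoef_closed alpha (m : nat) : 0 < alpha < 2 ->
  ucoef alpha m.+1 * Gamma_pos (m.+1%:R + alpha / 2) ^+ 2 =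
  Gamma_pos (alpha + 1) * (alpha / 2)
    * \prod_(k < m) (k.+1%:R ^+ 2 - (alpha / 2) ^+ 2).
Proof.
move=> a02; have /andP[a0 _] := a02.
elim: m => [|m IHm].
  rewrite big_ord0 mulr1 ucoef1// cc0E// [1%:R + _]addrC.
  have g0 : Gamma_pos (alpha / 2 + 1) != 0 by rewrite gt_eqF// Gamma_pos_gt0//; lra.
  by rewrite mulrA divfK ?expf_neq0// mulrC.
have mp : (0 : R) <= m%:R by [].
rewrite big_ord_recr/= [RHS]mulrA -IHm ucoefS//.
have -> : m.+2%:R + alpha / 2 = m.+1%:R + alpha / 2 + 1 by rewrite -(natr1 m.+1); ring.
have e1 := @natr1 R m; rewrite Gamma_posD1; last by lra.
rewrite -e1; field; rewrite gt_eqF//; lra.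
Qed.
End Coefficients.

(** * Elementary bounds for the sine *)

Section TrigBounds.
Variable R : realType.

(** Concavity of the sine on [[0, pi]]: the mean value theorem on [[0, y s]] and on [[y s, s]]
    compares two slopes, and the cosine decreases. *)
Lemma sin_chord (s y : R) : 0 <= s <= pi -> 0 <= y <= 1 ->
  y * sin s <= sin (y * s).
Proof.
move=> /andP[s0 spi] /andP[y0 y1].
have [->|sn0] := eqVneq s 0; first by rewrite !mulr0 sin0 mulr0.
have [->|yn0] := eqVneq y 0; first by rewrite !mul0r sin0.
have sp : 0 < s by rewrite lt_neqAle eq_sym sn0.
have yp : 0 < y by rewrite lt_neqAle eq_sym yn0.
have ys0 : 0 < y * s by rewrite mulr_gt0.
have yss : y * s <= s by rewrite ler_piMl.
have dsin (x : R) : is_derive x 1 sin (cos x) by exact: is_derive_sin.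
have csin (a b : R) : {within `[a, b], continuous (@sin R)}.
  by apply: continuous_subspaceT; exact: continuous_sin.
have [c1 c1i e1] := @MVT R sin cos 0 (y * s) ys0 (fun x _ => dsin x) (csin _ _).
have [c2 c2i e2] := @MVT_segment R sin cos (y * s) s yss (fun x _ => dsin x) (csin _ _).
move: c1i c2i; rewrite !in_itv/= => /andP[c10 c11] /andP[c20 c22].
have cc : cos c2 <= cos c1.
  have [->//|ne] := eqVneq c1 c2.
  by apply/ltW; rewrite ltr_cos ?in_itv/=; lra.
move: e1 e2; rewrite sin0 !subr0 => e1 e2.
have h : sin s - sin (y * s) <= cos c1 * (s - y * s).
  by rewrite e2 ler_wpM2r// subr_ge0.
have h2 : y * (sin s - sin (y * s)) <= y * (cos c1 * (s - y * s)) by rewrite ler_pM2l.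
have e3 : y * (cos c1 * (s - y * s)) = (1 - y) * sin (y * s) by rewrite e1; ring.
rewrite e3 in h2; lra.
Qed.

Lemma sin_pi_ge (y : R) : 0 <= y <= 2^-1 -> 2 * y <= sin (pi * y).
Proof.
move=> y01; have p0 := pi_gt0 R.
have := @sin_chord (pi / 2) (2 * y); rewrite sin_pihalf mulr1.
have -> : 2 * y * (pi / 2) = pi * y by field.
by apply; lra.
Qed.

Lemma cos_piquarter_sqr : cos (pi / 4 : R) ^+ 2 = 2^-1.
Proof.
have h := cos_mulr2n (pi / 4 : R).
have e : pi / 4 *+ 2 = pi / 2 :> R by rewrite -mulr_natr; field.
rewrite e cos_pihalf -mulr_natr in h; lra.
Qed.

(** Two duplications: [sin (pi y) = 2 sin (pi y / 2) cos (pi y / 2)] with [sin x <= x], and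
    [cos (pi y / 2) = 1 - 2 q^2], where the chord bound [q >= y sin (pi / 4)] gives
    [2 q^2 >= y^2]. *)
Lemma sin_pi_le (y : R) : 0 <= y <= 1 -> sin (pi * y) <= pi * y * (1 - y ^+ 2).
Proof.
move=> /andP[y0 y1]; have p0 := pi_gt0 R.
set q := sin (pi / 4 * y).
have hq : y ^+ 2 <= 2 * q ^+ 2.
  have h : y * sin (pi / 4 : R) <= q.
    by rewrite /q [pi / 4 * y]mulrC; apply: sin_chord; lra.
  have s0 : 0 <= y * sin (pi / 4 : R).
    by rewrite mulr_ge0// sin_ge0_pi//; lra.
  have := lerXn2r 2 s0 (le_trans s0 h) h.
  rewrite exprMn sin2cos2 cos_piquarter_sqr; lra.
have -> : pi * y = (pi * y / 2) *+ 2 by rewrite -mulr_natr; field.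
rewrite sin_mulr2n.
have ec : cos (pi * y / 2) = 1 - 2 * q ^+ 2.
  have -> : pi * y / 2 = (pi / 4 * y) *+ 2 by rewrite -mulr_natr; field.
  rewrite cos_mulr2n cos2sin2 -/q -mulr_natr; ring.
have c0 : 0 <= cos (pi * y / 2).
  by apply: cos_ge0_pihalf; rewrite -mulrA mulrCA; apply/andP; split; nra.
have sle : sin (pi * y / 2) <= pi * y / 2.
  have [->|yn0] := eqVneq y 0; first by rewrite mulr0 mul0r sin0.
  have yp : 0 < pi * y / 2 by rewrite divr_gt0// mulr_gt0// lt_neqAle eq_sym yn0.
  have [c _] := @MVT R sin cos 0 (pi * y / 2) yp (fun x _ => is_derive_sin x)
    (continuous_subspaceT (@continuous_sin R)).
  rewrite sin0 !subr0 => ->; rewrite ler_piMl ?cos_le1//; exact: ltW.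
rewrite -mulr_natr.
have : cos (pi * y / 2) * sin (pi * y / 2) <= cos (pi * y / 2) * (pi * y / 2).
  by rewrite ler_wpM2l.
rewrite ec => h.
have h2 : (1 - 2 * q ^+ 2) * (pi * y / 2) <= (1 - y ^+ 2) * (pi * y / 2).
  by rewrite ler_wpM2r ?divr_ge0 ?mulr_ge0 ?pi_ge0//; lra.
lra.
Qed.
End TrigBounds.

(** * Bounds of the tails by [theta] and [theta0] *)

Section CoefficientBounds.
Variable R : realType.
Implicit Types alpha : R.

(** With [n = 5 + alpha / 2] and [x = (1 + alpha) / n] the factor is [((1 - x) e^x)^n]. The base is
    at most [20 / 21] for [x >= 4 / 11], and [(20 / 21)^5 <= 4 / 5]. *)
Lemma theta_factor_le alpha : 1 < alpha -> alpha < 2 ->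
  (1 - (1 + alpha) / (5 + alpha / 2)) `^ (5 + alpha / 2) * expR (1 + alpha)
    <= 4 / 5.
Proof.
move=> a1 a2; set n := 5 + alpha / 2; set x := (1 + alpha) / n.
have n5 : 5 <= n by rewrite /n; lra.
have n0 : 0 < n by lra.
have xE : x * n = 1 + alpha by rewrite /x divfK// gt_eqF.
have x_ge : 4 / 11 <= x by rewrite /x ler_pdivlMr// /n; lra.
have x_le : x <= 1 / 2 by rewrite /x ler_pdivrMr// /n; lra.
rewrite -xE expRM -powRM ?expR_ge0//; last by lra.
have base : (1 - x) * expR x <= 20 / 21.
  have h := expR_ge1Dx (- (x / 2)).
  have h2 : (1 - x / 2) ^+ 2 <= expR (- x).
    have -> : - x = - (x / 2) + - (x / 2) by field.
    by rewrite expRD -expr2 lerXn2r// ?nnegrE ?expR_ge0//; lra.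
  have e0 := expR_gt0 x.
  have e1 : expR x * expR (- x) = 1 by rewrite -expRD subrr expR0.
  have h3 : expR x * (1 - x / 2) ^+ 2 <= 1.
    by have := ler_wpM2l (ltW e0) h2; rewrite e1.
  have h4 : 21 / 20 * (1 - x) <= (1 - x / 2) ^+ 2 by nra.
  have h5 : expR x * (21 / 20 * (1 - x)) <= expR x * (1 - x / 2) ^+ 2 by rewrite ler_pM2l.
  lra.
have base0 : 0 <= (1 - x) * expR x by rewrite mulr_ge0 ?expR_ge0//; lra.
apply: (@le_trans _ _ ((20 / 21) `^ n)).
  by apply: ge0_ler_powR; rewrite ?nnegrE//; lra.
apply: (@le_trans _ _ ((20 / 21) `^ 5)).
  by apply: ger_powR => //; lra.
by rewrite powR_mulrn; lra.
Qed.

Lemma theta_gt0 alpha : 1 < alpha -> alpha < 2 -> 0 < theta alpha.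
Proof.
move=> a1 a2; have p0 := pi_gt0 R.
have n0 : 0 < 5 + alpha / 2 by lra.
apply: divr_gt0; last by rewrite mulr_gt0//; lra.
apply: mulr_gt0; last first.
  by rewrite sin_gt0_pi// -mulrA; apply/andP; split; nra.
apply: mulr_gt0; last by rewrite Gamma_gt0E ?Gamma_pos_gt0//; lra.
by rewrite mulr_gt0 ?expR_gt0// powR_gt0// subr_gt0 ltr_pdivrMr//; lra.
Qed.

Lemma theta0_gt0 alpha : 1 < alpha -> alpha < 2 -> 0 < theta0 alpha.
Proof.
move=> a1 a2; have p0 := pi_gt0 R.
apply: divr_gt0; last by rewrite mulr_gt0//; lra.
apply: mulr_gt0; last first.
  by rewrite sin_gt0_pi// -mulrA; apply/andP; split; nra.
apply: mulr_gt0; last by rewrite Gamma_gt0E ?Gamma_pos_gt0//; lra.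
by rewrite mulr_gt0 ?expR_gt0// sqrtr_gt0.
Qed.

Lemma sin_pihalf_sub alpha : sin (pi * alpha / 2 : R) = sin (pi * (1 - alpha / 2)).
Proof.
have -> : pi * (1 - alpha / 2) = - (pi * alpha / 2) + pi by field.
by rewrite sinDpi sinN opprK.
Qed.

Lemma prod_sqr_sub (b : R) (m : nat) :
  \prod_(k < m) (k.+1%:R ^+ 2 - b ^+ 2) =
  m`!%:R ^+ 2 * \prod_(k < m) (1 - b ^+ 2 / k.+1%:R ^+ 2).
Proof.
elim: m => [|m IHm]; first by rewrite !big_ord0 mulr1 expr1n.
rewrite !big_ord_recr/= IHm factS natrM.
by field; rewrite addrC natr1 pnatr_eq0.
Qed.

(** Partial product of Euler's product for [sin (pi b) / (pi b)]. *)
Definition euler_prod (b : R) (m : nat) : R :=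
  \prod_(k < m) (1 - b ^+ 2 / k.+1%:R ^+ 2).

Lemma euler_prod_ge0 (b : R) (m : nat) : 0 <= b <= 1 -> 0 <= euler_prod b m.
Proof.
move=> b01; apply: prodr_ge0 => k _.
rewrite subr_ge0 ler_pdivrMr ?exprn_gt0// mul1r.
have k1 : (1 : R) <= k.+1%:R by rewrite ler1n.
by nra.
Qed.

(** Only the first two factors are kept; every later one is at most [1]. *)
Lemma euler_prod_le (b : R) (m : nat) : 0 <= b <= 1 ->
  euler_prod b m.+2 <= (1 - b ^+ 2) * (1 - b ^+ 2 / 4).
Proof.
move=> b01; elim: m => [|m IHm].
  rewrite /euler_prod !big_ord_recr big_ord0/=; lra.
rewrite /euler_prod big_ord_recr/=; apply: le_trans IHm.
by rewrite ler_piMr ?euler_prod_ge0// gerBl divr_ge0// sqr_ge0.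
Qed.

(* The tail of the product is controlled by [1/k^2 <= 1/(k-1/2) - 1/(k+1/2)]. *)
Lemma euler_prod_ge (b : R) (m : nat) : 0 <= b <= 1 ->
  (1 - b ^+ 2) * (1 - b ^+ 2 / 4) * (1 - 2 / 5 * b ^+ 2) <= euler_prod b m.+2.
Proof.
move=> b01; set c := (1 - b ^+ 2) * (1 - b ^+ 2 / 4).
have c0 : 0 <= c by rewrite /c mulr_ge0//; nra.
have b2 : 0 <= b ^+ 2 <= 1 by apply/andP; split; nra.
(* The inner difference is the telescoped sum of [1/(k-1/2) - 1/(k+1/2)] over [3 <= k <= m + 2];
   carrying it makes the induction close. *)
suff h : c * (1 - b ^+ 2 * (2 / 5 - (m%:R + 5 / 2)^-1)) <= euler_prod b m.+2.
  apply: le_trans h; rewrite ler_wpM2l//.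
  have : 0 <= b ^+ 2 * (m%:R + 5 / 2)^-1.
    by rewrite mulr_ge0 ?invr_ge0 ?addr_ge0//; lra.
  lra.
elim: m => [|m IHm].
  rewrite /euler_prod !big_ord_recr big_ord0/= /c.
  by rewrite le_eqVlt; apply/orP; left; apply/eqP; field.
rewrite /euler_prod big_ord_recr/= -/(euler_prod b m.+2).
have m0 : (0 : R) <= m%:R by [].
have e3 : m.+3%:R = m%:R + 3 :> R by rewrite -natrD addn3.
rewrite e3 -(natr1 m).
set p := euler_prod b m.+2 in IHm *.
have q0 : 0 <= 1 - b ^+ 2 / (m%:R + 3) ^+ 2.
  by rewrite subr_ge0 ler_pdivrMr ?exprn_gt0; nra.
apply: le_trans (ler_wpM2r q0 IHm).
rewrite -[leRHS]mulrA ler_wpM2l//.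
set s := 2 / 5 - (m%:R + 5 / 2)^-1.
have s0 : 0 <= s.
  by rewrite /s subr_ge0 -[leRHS]invrK lef_pV2 ?posrE//; lra.
have hq : (m%:R + 3) ^- 2 <= (m%:R + 5 / 2)^-1 - (m%:R + 1 + 5 / 2)^-1 :> R.
  have -> : (m%:R + 5 / 2)^-1 - (m%:R + 1 + 5 / 2)^-1 =
    ((m%:R + 5 / 2) * (m%:R + 1 + 5 / 2))^-1 :> R.
    by field; rewrite !gt_eqF//; lra.
  by rewrite lef_pV2 ?posrE ?exprn_gt0 ?mulr_gt0//; nra.
set r := (m%:R + 3) ^- 2 in hq q0 *.
have r0 : 0 <= r by rewrite /r invr_ge0 exprn_ge0//; lra.
have h1 : b ^+ 2 * r <= b ^+ 2 * ((m%:R + 5 / 2)^-1 - (m%:R + 1 + 5 / 2)^-1).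
  by rewrite ler_wpM2l//; lra.
have h2 : 0 <= b ^+ 2 * s * (b ^+ 2 * r) by rewrite !mulr_ge0//; lra.
rewrite /s in h2 *; lra.
Qed.

(** Log-convexity from [n + b] to [n + 1] gives [(n + b)^b n! <= Gamma(n + 1 + b)], which is squared
    and put into [ucoef_closed]. *)
Lemma ucoef_le alpha (n : nat) : 0 < alpha < 2 ->
  ucoef alpha n.+1 * (n%:R + alpha / 2) `^ alpha
    <= Gamma_pos (alpha + 1) * (alpha / 2) * euler_prod (alpha / 2) n.
Proof.
move=> a02; have /andP[a0 a2] := a02; set b := alpha / 2.
have n0 : (0 : R) <= n%:R by [].
have s0 : 0 < n%:R + b by rewrite /b; lra.
have d01 : 0 <= 1 - b <= 1 by rewrite /b; lra.
have := Gamma_pos_log_convex s0 d01.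
have -> : n%:R + b + (1 - b) = n.+1%:R by rewrite -natr1; ring.
rewrite Gamma_pos_nat => h.
have f0 : 0 < n`!%:R :> R by rewrite ltr0n fact_gt0.
have p0 : 0 < (n%:R + b) `^ b by rewrite powR_gt0.
have h1 : (n%:R + b) `^ b * n`!%:R <= Gamma_pos (n.+1%:R + b).
  have -> : n.+1%:R + b = n%:R + b + 1 by rewrite -natr1; ring.
  rewrite Gamma_posD1//.
  have wE : (n%:R + b) `^ b * (n%:R + b) `^ (1 - b) = n%:R + b :> R.
    rewrite -powRD ?(gt_eqF s0) ?implybT//.
    by rewrite [b + _]addrC subrK powRr1// ltW.
  by rewrite -{2}wE -mulrA ler_pM2l.
have := ucoef_closed n a02; rewrite prod_sqr_sub -/b -/(euler_prod b n) => e.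
have u0 := @ucoef_gt0 R alpha n.+1 a02 isT.
have -> : alpha = b + b by rewrite /b; field.
rewrite powRD ?(gt_eqF s0) ?implybT//.
have -> : b + b = alpha by rewrite /b; field.
set w := (n%:R + b) `^ b in p0 h1 *.
have h2 : (w * n`!%:R) ^+ 2 <= Gamma_pos (n.+1%:R + b) ^+ 2.
  have h3 : 0 <= w * n`!%:R by rewrite mulr_ge0// ltW.
  by rewrite lerXn2r ?nnegrE// (le_trans h3).
have h3 := ler_wpM2l (ltW u0) h2.
rewrite e in h3.
have f2 : 0 < n`!%:R ^+ 2 :> R by rewrite exprn_gt0.
rewrite -(ler_pM2l f2); clear -h3.
move: (ucoef _ _) (Gamma_pos (alpha + 1)) (euler_prod _ _) h3 => u g E h3.
lra.
Qed.

(** The opposite estimate, [Gamma(n + 1 + b) <= (n + 1)^b n!], is log-convexity from [n + 1] to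
    [n + 1 + b]. *)
Lemma ucoef_ge alpha (n : nat) : 0 < alpha < 2 ->
  Gamma_pos (alpha + 1) * (alpha / 2) * euler_prod (alpha / 2) n
    <= ucoef alpha n.+1 * n.+1%:R `^ alpha.
Proof.
move=> a02; have /andP[a0 a2] := a02; set b := alpha / 2.
have d01 : 0 <= b <= 1 by rewrite /b; lra.
have s0 : (0 : R) < n.+1%:R by [].
have := Gamma_pos_log_convex s0 d01; rewrite Gamma_pos_nat => h1.
have f0 : 0 < n`!%:R :> R by rewrite ltr0n fact_gt0.
have := ucoef_closed n a02; rewrite prod_sqr_sub -/b -/(euler_prod b n) => e.
have u0 := @ucoef_gt0 R alpha n.+1 a02 isT.
have -> : n.+1%:R `^ alpha = n.+1%:R `^ b * n.+1%:R `^ b :> R.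
  by rewrite -powRD ?(gt_eqF s0) ?implybT//; congr powR; rewrite /b; field.
have p0 : 0 < n.+1%:R `^ b :> R by rewrite powR_gt0.
set w := n.+1%:R `^ b in p0 h1 *.
have h2 : Gamma_pos (n.+1%:R + b) ^+ 2 <= (w * n`!%:R) ^+ 2.
  rewrite lerXn2r ?nnegrE ?(ltW (mulr_gt0 p0 f0))//.
  by rewrite ltW// Gamma_pos_gt0// /b; lra.
have h3 := ler_wpM2l (ltW u0) h2.
rewrite e in h3.
have f2 : 0 < n`!%:R ^+ 2 :> R by rewrite exprn_gt0.
rewrite -(ler_pM2l f2); clear -h3.
move: (ucoef _ _) (Gamma_pos (alpha + 1)) (euler_prod _ _) h3 => u g E h3.
lra.
Qed.

(** With [b = alpha / 2], the Gamma factor, [pi] and [b (1 - b)] cancel once [sin (pi b)] is bounded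
    by [sin_pi_le] at [1 - b]. There remains [4/5 (2 - b) <= (1 + b)(1 - b^2/4)(1 - 2 b^2/5)] on
    [[1/2, 1]]. The condition [n >= 3] supplies the two factors that [euler_prod_ge] isolates. *)
Lemma ucoef_ge_theta alpha (n : nat) : 1 < alpha -> alpha < 2 -> (3 <= n)%N ->
  theta alpha / n%:R `^ alpha <= ucoef alpha n / alpha.
Proof.
move=> a1 a2; case: n => [|[|[|n]]]// _.
have a0 : 0 < alpha by lra.
have a02 : 0 < alpha < 2 by rewrite a0.
have b01 : 0 <= alpha / 2 <= 1 by lra.
have pp := pi_gt0 R.
have w0 : 0 < n.+3%:R `^ alpha :> R by rewrite powR_gt0.
rewrite ler_pdivrMr// mulrAC ler_pdivlMr//.
apply: le_trans (ucoef_ge n.+2 a02).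
have g0 : 0 < Gamma_pos (alpha + 1) by rewrite Gamma_pos_gt0//; lra.
have hE := euler_prod_ge n b01.
have hs : sin (pi * alpha / 2) <= pi * (1 - alpha / 2) * (1 - (1 - alpha / 2) ^+ 2).
  by rewrite sin_pihalf_sub; apply: sin_pi_le; lra.
have s0 : 0 <= sin (pi * alpha / 2).
  by rewrite sin_ge0_pi// -mulrA; apply/andP; split; nra.
have hr := theta_factor_le a1 a2.
rewrite /theta Gamma_gt0E; last by lra.
move: hr; set r := _ `^ _ * _ => hr.
set g := Gamma_pos _ in g0 *; set s := sin _ in hs s0 *; clearbody s.
have -> : r * g * s / (pi * alpha) * alpha = g * (r * s / pi).
  clear -pp a0; move: pi pp => p pp.
  by field; rewrite (gt_eqF pp) (gt_eqF a0).
rewrite -[leRHS]mulrA ler_pM2l// ler_pdivrMr//.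
set E := euler_prod _ _ in hE *; set b := alpha / 2 in b01 hs hE *.
have h1 : r * s <= 4 / 5 * s by rewrite ler_wpM2r.
apply: (le_trans h1).
have h2 : 4 / 5 * s <= 4 / 5 * (pi * (1 - b) * (1 - (1 - b) ^+ 2)) by lra.
apply: (le_trans h2).
have h3 : b * ((1 - b ^+ 2) * (1 - b ^+ 2 / 4) * (1 - 2 / 5 * b ^+ 2)) * pi <= b * E * pi.
  by rewrite ler_pM2r// ler_wpM2l//; lra.
apply: le_trans h3.
rewrite (_ : 4 / 5 * _ = (b * (1 - b) * pi) * (4 / 5 * (2 - b))); last by ring.
rewrite [leRHS](_ : _ = (b * (1 - b) * pi) * ((1 + b) * (1 - b ^+ 2 / 4) * (1 - 2 / 5 * b ^+ 2))); last by ring.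
have b12 : 1 / 2 <= b <= 1 by rewrite /b; lra.
rewrite ler_wpM2l//; first by rewrite !mulr_ge0//; lra.
clear -b12; have /andP[b1 b2] := b12.
(* In the expanded product the square and the cube have negative coefficients and are bounded by
   chords; the fourth and fifth powers have positive ones and are bounded through the tangent of the
   square function at [b^2 = 9/16]. *)
have c2 : b ^+ 2 <= 3 / 2 * b - 1 / 2 by nra.
have c3 : b ^+ 3 <= 7 / 4 * b - 3 / 4.
  have : b * b ^+ 2 <= b * (3 / 2 * b - 1 / 2) by rewrite ler_wpM2l//; lra.
  rewrite -exprS; nra.
have c4 : 9 / 8 * b ^+ 2 - 81 / 256 <= b ^+ 4.
  have := sqr_ge0 (b ^+ 2 - 9 / 16); rewrite sqrrB -exprM; lra.
have c5 : b * (9 / 8 * b ^+ 2 - 81 / 256) <= b * b ^+ 4 by rewrite ler_wpM2l//; lra.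
lra.
Qed.

(** With [b = alpha / 2], [E] the Euler product and [c = sqrt 2 e^(13/12) > 3], the chain is [b E pi
    <= 3/2 (1 - b) pi <= 6 (1 - b) < 2 c (1 - b) <= c sin (pi b)]. It uses [pi < 4] and Jordan's
    inequality; the strictness comes from [c > 3]. *)
Lemma ucoef_lt_theta0 alpha (n : nat) : 1 < alpha -> alpha < 2 -> (2 <= n)%N ->
  ucoef alpha n.+1 / alpha < theta0 alpha / (n%:R - 1) `^ alpha.
Proof.
move=> a1 a2; case: n => [|[|n]]// _.
have a0 : 0 < alpha by lra.
have a02 : 0 < alpha < 2 by rewrite a0.
have b01 : 0 <= alpha / 2 <= 1 by lra.
have pp := pi_gt0 R; have n0 : (0 : R) <= n%:R by [].
have e1 : n.+2%:R = n%:R + 2 :> R by rewrite -natrD addn2.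
have w0 : 0 < (n.+2%:R - 1) `^ alpha :> R by rewrite powR_gt0// e1; lra.
rewrite ltr_pdivlMr// mulrAC ltr_pdivrMr//.
have u0 := @ucoef_gt0 R alpha n.+3 a02 isT.
have hw : (n.+2%:R - 1) `^ alpha <= (n.+2%:R + alpha / 2) `^ alpha.
  by apply: ge0_ler_powR; rewrite ?nnegrE ?e1; lra.
apply: (le_lt_trans (ler_wpM2l (ltW u0) hw)).
apply: (le_lt_trans (ucoef_le n.+2 a02)).
have g0 : 0 < Gamma_pos (alpha + 1) by rewrite Gamma_pos_gt0//; lra.
have hE := euler_prod_le n b01.
rewrite /theta0 Gamma_gt0E; last by lra.
have hs : 2 * (1 - alpha / 2) <= sin (pi * alpha / 2).
  by rewrite sin_pihalf_sub; apply: sin_pi_ge; lra.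
set g := Gamma_pos _ in g0 *; set s := sin _ in hs *; clearbody s.
have hc : 3 < Num.sqrt 2 * expR (13 / 12) :> R.
  have h1 : 7 / 5 <= Num.sqrt 2 :> R.
    by rewrite -(@ler_pXn2r _ 2) ?nnegrE ?sqrtr_ge0// sqr_sqrtr//; lra.
  have h2 := expR_ge1Dx (13 / 24 : R).
  have -> : 13 / 12 = 13 / 24 + 13 / 24 :> R by field.
  rewrite expRD; nra.
set c := Num.sqrt 2 * _ in hc *.
have -> : c * g * s / (pi * alpha) * alpha = g * (c * s / pi).
  clear -pp a0; move: pi pp => p pp.
  by field; rewrite (gt_eqF pp) (gt_eqF a0).
rewrite -mulrA ltr_pM2l// ltr_pdivlMr//.
set E := euler_prod _ _ in hE *; set b := alpha / 2 in b01 hs hE *.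
have b12 : 1 / 2 <= b < 1 by rewrite /b; lra.
have h1 : b * E <= 3 / 2 * (1 - b).
  have : b * E <= b * ((1 - b ^+ 2) * (1 - b ^+ 2 / 4)) by rewrite ler_wpM2l//; lra.
  move/le_trans; apply.
  rewrite [leLHS](_ : _ = (1 - b) * ((b * (2 - b)) * ((1 + b) * (2 + b) / 4))); last by field.
  have k1 : b * (2 - b) <= 1 by nra.
  have k2 : 0 <= (1 + b) * (2 + b) / 4 <= 3 / 2 by apply/andP; split; nra.
  rewrite [leRHS]mulrC ler_wpM2l//; first lra.
  have /andP[k3 k4] := k2.
  by apply: le_trans k4; rewrite ler_piMl.
have p4 : pi < 4 :> R by have := @pihalf_lt2 R; lra.
have h2 : b * E * pi <= 3 / 2 * (1 - b) * pi by rewrite ler_pM2r.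
have h3 : 3 / 2 * (1 - b) * pi <= 3 / 2 * (1 - b) * 4 by rewrite ler_wpM2l//; lra.
have h4 : c * (2 * (1 - b)) <= c * s by rewrite ler_wpM2l//; lra.
have h5 : 3 * (2 * (1 - b)) < c * (2 * (1 - b)) by rewrite ltr_pM2r//; lra.
lra.
Qed.
End CoefficientBounds.

(** * Skew block matrices and preconditioners *)

Section SkewMatrices.
Variable R : realType.

Definition sqn n (v : 'cV[R]_n) : R := \sum_i v i 0 ^+ 2.

Lemma sqn_ge0 n (v : 'cV[R]_n) : 0 <= sqn v.
Proof. by apply: sumr_ge0 => i _; exact: sqr_ge0. Qed.

Lemma sqn_eq0 n (v : 'cV[R]_n) : sqn v = 0 -> v = 0.
Proof.
move=> /eqP; rewrite psumr_eq0 => [/allP h|i _]; last exact: sqr_ge0.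
apply/colP => i; rewrite mxE; apply/eqP.
by have := h i (mem_index_enum _); rewrite /= sqrf_eq0.
Qed.

Lemma sqnZ n (c : R) (v : 'cV[R]_n) : sqn (c *: v) = c ^+ 2 * sqn v.
Proof. by rewrite mulr_sumr; apply: eq_bigr => i _; rewrite mxE exprMn. Qed.

Lemma sqnN n (v : 'cV[R]_n) : sqn (- v) = sqn v.
Proof. by rewrite -scaleN1r sqnZ sqrrN expr1n mul1r. Qed.

Lemma sqn_col_mx m n (u : 'cV[R]_m) (v : 'cV[R]_n) :
  sqn (col_mx u v) = sqn u + sqn v.
Proof.
rewrite /sqn big_split_ord; congr (_ + _); apply: eq_bigr => i _.
  by rewrite col_mxEu.
by rewrite col_mxEd.
Qed.

Lemma sqn_add n (u v : 'cV[R]_n) :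
  sqn (u + v) = sqn u + sqn v + 2 * (u^T *m v) 0 0.
Proof.
have -> : (u^T *m v) 0 0 = \sum_i u i 0 * v i 0.
  by rewrite mxE; apply: eq_bigr => i _; rewrite mxE.
rewrite /sqn mulr_sumr -!big_split; apply: eq_bigr => i _ /=.
by rewrite mxE; ring.
Qed.

(** A [1 x 1] matrix is its own transpose, and here the transpose is also its opposite. *)
Lemma skew_form n (A : 'M[R]_n) (v : 'cV[R]_n) : A^T = - A ->
  (v^T *m (A *m v)) 0 0 = 0.
Proof.
move=> sA; have e : (v^T *m (A *m v))^T = - (v^T *m (A *m v)).
  by rewrite !trmx_mul trmxK sA mulmxN mulNmx mulmxA.
have := congr1 (fun B : 'M[R]_(1, 1) => B 0 0) e; rewrite !mxE => h; lra.
Qed.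

Lemma sqn_scalar_add_skew n (c : R) (A : 'M[R]_n) (v : 'cV[R]_n) :
  A^T = - A ->
  sqn ((c%:M + A) *m v) = c ^+ 2 * sqn v + sqn (A *m v).
Proof.
move=> sA; rewrite mulmxDl mul_scalar_mx sqn_add sqnZ linearZ/= -scalemxAl.
by rewrite [X in 2 * X]mxE skew_form// !mulr0 addr0.
Qed.

Lemma scalar_add_skew_unitmx n (c : R) (A : 'M[R]_n) : c != 0 -> A^T = - A ->
  c%:M + A \in unitmx.
Proof.
move=> c0 sA; rewrite -unitmx_tr -row_free_unit; apply: inj_row_free => v vA.
have h : (c%:M + A) *m v^T = 0 by rewrite -[_ *m _]trmxK trmx_mul trmxK vA trmx0.
have := sqn_scalar_add_skew c v^T sA; rewrite h.
have -> : sqn (0 : 'cV[R]_n) = 0.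
  by rewrite /sqn big1// => i _; rewrite mxE expr0n.
move=> e; have s1 := sqn_ge0 v^T; have s2 := sqn_ge0 (A *m v^T).
have c2 : 0 < c ^+ 2 by rewrite exprn_even_gt0.
have : sqn v^T = 0 by nra.
by move/sqn_eq0 => /(congr1 trmx); rewrite trmxK trmx0.
Qed.

Definition bigK n (S : 'M[R]_n) : 'M[R]_(n + n) := block_mx 0 S (- S) 0.

Lemma tr_bigK n (S : 'M[R]_n) : S^T = S -> (bigK S)^T = - bigK S.
Proof.
move=> sS; rewrite /bigK tr_block_mx opp_block_mx !trmx0 !oppr0 opprK.
by rewrite linearN/= sS.
Qed.

Lemma bigK_sub n (S U : 'M[R]_n) : bigK S - bigK U = bigK (S - U).
Proof.
by rewrite /bigK opp_block_mx add_block_mx !subr0 opprK opprB [- S + U]addrC.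
Qed.

Lemma bigK_add n (S U : 'M[R]_n) : bigK S + bigK U = bigK (S + U).
Proof. by rewrite /bigK add_block_mx !addr0 opprD. Qed.

Lemma sqn_bigK n (S : 'M[R]_n) (v : 'cV[R]_(n + n)) :
  sqn (bigK S *m v) = sqn (S *m dsubmx v) + sqn (S *m usubmx v).
Proof.
rewrite -{1}[v]vsubmxK mul_block_col !mul0mx add0r addr0 sqn_col_mx mulNmx.
by rewrite sqnN.
Qed.

Lemma sqn_submx n (v : 'cV[R]_(n + n)) : sqn v = sqn (usubmx v) + sqn (dsubmx v).
Proof. by rewrite -{1}[v]vsubmxK sqn_col_mx. Qed.

Lemma sqn_bigK_le n (S : 'M[R]_n) (l : R) :
  (forall v, sqn (S *m v) <= l * sqn v) ->
  forall v, sqn (bigK S *m v) <= l * sqn v.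
Proof.
by move=> h v; rewrite sqn_bigK sqn_submx mulrDr addrC lerD.
Qed.

Lemma sqn_bigK_ge n (S : 'M[R]_n) (l : R) :
  (forall v, l * sqn v <= sqn (S *m v)) ->
  forall v, l * sqn v <= sqn (bigK S *m v).
Proof.
by move=> h v; rewrite sqn_bigK sqn_submx mulrDr [leRHS]addrC lerD.
Qed.

(** Multiplication by the rotation [J] turns [bigK S] into the block diagonal matrix with blocks [S]
    and [S]. *)
Lemma rank_bigK n (S : 'M[R]_n) : (\rank (bigK S) = \rank S + \rank S)%N.
Proof.
pose J : 'M[R]_(n + n) := block_mx 0 (- 1%:M) 1%:M 0.
have uJ : J \in unitmx.
  have : J *m (block_mx 0 1%:M (- 1%:M) 0) = 1%:M.
    rewrite mulmx_block !mul0mx !mulmx0 !mul1mx !mulNmx !mul1mx opprK.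
    by rewrite !add0r !addr0 -scalar_mx_block.
  by case/mulmx1_unit.
have -> : \rank (bigK S) = \rank (J *m bigK S).
  by apply/esym/eqP; rewrite eqmxMfull// row_full_unit.
rewrite mulmx_block !mul0mx !mulmx0 !mul1mx mulNmx mul1mx opprK !add0r !addr0.
exact: rank_diag_block_mx.
Qed.

Lemma bigTE n (A : 'M[R]_n) : bigT A = 1%:M + bigK A.
Proof.
by rewrite /bigT /bigK (@scalar_mx_block _ n n) add_block_mx !addr0 !add0r.
Qed.

Lemma bigDE n (A : 'M[R]_n) : bigD A = bigK (- A).
Proof. by rewrite /bigD /bigK opprK. Qed.

Lemma bigRE n (T D : 'M[R]_n) : bigR T D = 1%:M + bigK (T - D).
Proof.
by rewrite /bigR /bigK (@scalar_mx_block _ n n) add_block_mx !addr0 !add0r opprB.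
Qed.

Lemma bigR_TD n (T D : 'M[R]_n) : bigR T D = bigT T + bigD D.
Proof. by rewrite bigRE bigTE bigDE -addrA bigK_add. Qed.

Lemma shift_bigT n (w : R) (A : 'M[R]_n) :
  w%:M + bigT A = (w + 1)%:M + bigK A.
Proof. by rewrite bigTE addrA -raddfD. Qed.
End SkewMatrices.

Section Preconditioners.
Variables (R : realType) (n : nat).
Implicit Types (T C D L : 'M[R]_n) (w : R).

(** Parallelogram law with the term [sqn (u + v)] dropped. *)
Lemma sqn_sub_le m (u v : 'cV[R]_m) : sqn (u - v) <= 2 * (sqn u + sqn v).
Proof.
have h := sqn_ge0 (u + v).
have := sqn_add u v; have := sqn_add u (- v).
rewrite mulmxN [X in 2 * X]mxE sqnN => e1 e2.
rewrite e1; rewrite e2 in h; lra.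
Qed.

Lemma shift_bigT_unitmx w T : 0 < w -> T^T = T -> w%:M + bigT T \in unitmx.
Proof.
move=> w0 sT; rewrite shift_bigT scalar_add_skew_unitmx ?tr_bigK//.
by rewrite gt_eqF//; lra.
Qed.

Lemma shift_bigD_unitmx w D : 0 < w -> D^T = D -> w%:M + bigD D \in unitmx.
Proof.
move=> w0 sD; rewrite bigDE scalar_add_skew_unitmx ?gt_eqF//.
by rewrite tr_bigK// linearN/= sD.
Qed.

Lemma sqn_shift_bigD w D x : D^T = D ->
  sqn ((w%:M + bigD D) *m x) = w ^+ 2 * sqn x + sqn (bigK D *m x).
Proof.
move=> sD; rewrite bigDE sqn_scalar_add_skew; last first.
  by rewrite tr_bigK// linearN/= sD.
congr (_ + _); rewrite -[- D]sub0r -bigK_sub.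
have -> : bigK (0 : 'M[R]_n) = 0 by rewrite /bigK oppr0 block_mx0.
by rewrite sub0r mulNmx sqnN.
Qed.

(* With [A = w + bigT T] and [Z = bigD D],
   [2 w (bigT T + Z) = A (w + Z) - (w - bigT T) (w - Z)], and the Cayley
   transform [(w - bigT T) A^-1] is a contraction. *)
Lemma sqn_half_step_le w (nu2 : R) T D x : 0 < w -> T^T = T -> D^T = D ->
  (forall v, sqn (D *m v) <= nu2 * sqn v) ->
  sqn (invmx (w%:M + bigT T) *m ((2 * w) *: (bigR T D *m x)))
    <= 4 * (w ^+ 2 + nu2) * sqn x.
Proof.
move=> w0 sT sD hD.
have uA := shift_bigT_unitmx w0 sT.
set A := w%:M + bigT T in uA *.
pose B := w%:M - bigT T.
pose q := (w%:M - bigD D) *m x.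
pose g := invmx A *m q.
have AB : A *m B = B *m A.
  rewrite /A /B !mulmxDl !mulmxDr !mulNmx !mulmxN !mul_mx_scalar !mul_scalar_mx.
  move: (bigT T *m bigT T) => X2.
  by apply/matrixP => i j; rewrite !mxE; ring.
have -> : invmx A *m ((2 * w) *: (bigR T D *m x))
    = (w%:M + bigD D) *m x - B *m g.
  apply: (can_inj (mulKmx uA)); rewrite mulKVmx// mulmxBr [A *m (B *m g)]mulmxA AB.
  rewrite -[B *m A *m g]mulmxA mulKVmx// /q !mulmxA -mulmxBl scalemxAl.
  congr (_ *m x); rewrite bigR_TD /A /B.
  move: (bigT T) (bigD D) => X Y.
  rewrite !mulmxDl !mulmxDr !mulNmx !mulmxN !mul_mx_scalar !mul_scalar_mx.
  move: (X *m Y) => XY.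
  apply/matrixP => i j; rewrite !mxE; ring.
apply: (le_trans (sqn_sub_le _ _)).
have h1 : sqn ((w%:M + bigD D) *m x) <= (w ^+ 2 + nu2) * sqn x.
  by rewrite sqn_shift_bigD// mulrDl lerD2l; exact: sqn_bigK_le.
have h2 : sqn q <= (w ^+ 2 + nu2) * sqn x.
  have -> : q = (w%:M + bigD (- D)) *m x.
    by rewrite /q; congr ((_ + _) *m _); rewrite /bigD opp_block_mx !oppr0.
  rewrite sqn_shift_bigD ?linearN/= ?sD// mulrDl lerD2l; apply: sqn_bigK_le => v.
  by rewrite mulNmx sqnN.
(* [A] and [B] have opposite skew parts, so only their scalar parts differ, and
   [(w - 1)^2 <= (w + 1)^2]. *)
have h3 : sqn (B *m g) <= sqn q.
  have -> : q = A *m g by rewrite mulKVmx.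
  rewrite /A shift_bigT sqn_scalar_add_skew ?tr_bigK//.
  have -> : B = (w - 1)%:M + bigK (- T).
    by rewrite /B bigTE opprD addrA -raddfB /bigK opp_block_mx !oppr0.
  rewrite sqn_scalar_add_skew ?tr_bigK ?linearN/= ?sT//.
  rewrite !sqn_bigK !mulNmx !sqnN lerD2r.
  by rewrite ler_wpM2r ?sqn_ge0//; nra.
lra.
Qed.

(** The matrix [L] takes the place of [T - C]. The term is additive in [L], so any splitting of
    [T - C] splits the difference of the preconditioned matrices. *)
Definition precond_term w T C D L : 'M[R]_(n + n) :=
  invmx (w%:M + bigD D) *m (invmx (w%:M + bigT C) *m
    (bigK L *m (invmx (w%:M + bigT T) *m ((2 * w) *: bigR T D)))).

Lemma precond_termD w T C D L1 L2 : precond_term w T C D (L1 + L2) =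
  precond_term w T C D L1 + precond_term w T C D L2.
Proof. by rewrite /precond_term -bigK_add mulmxDl !mulmxDr. Qed.

Lemma invmx_precond w (X Y : 'M[R]_(n + n)) : 0 < w ->
  w%:M + X \in unitmx -> w%:M + Y \in unitmx ->
  invmx (precond w X Y) = (2 * w) *: (invmx (w%:M + Y) *m invmx (w%:M + X)).
Proof.
move=> w0 uX uY; have w2 : 2 * w != 0 by rewrite gt_eqF//; lra.
have u : precond w X Y \in unitmx.
  by rewrite /precond unitmxZ ?unitfE ?invr_eq0// unitmx_mul uX.
apply: (can_inj (mulKmx u)); rewrite mulmxV// /precond -scalemxAl -scalemxAr.
rewrite scalerA mulVf// scale1r !mulmxA -[_ *m (w%:M + Y) *m _]mulmxA.
by rewrite mulmxV// mulmx1 mulmxV.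
Qed.

(** The resolvent identity [Y^-1 - X^-1 = Y^-1 (X - Y) X^-1] for [X = w + bigT T] and
    [Y = w + bigT C]. *)
Lemma precond_diff w T C D : 0 < w -> T^T = T -> C^T = C -> D^T = D ->
  invmx (precond w (bigT C) (bigD D)) *m bigR T D =
  invmx (precond w (bigT T) (bigD D)) *m bigR T D
    + precond_term w T C D (T - C).
Proof.
move=> w0 sT sC sD.
have uT := shift_bigT_unitmx w0 sT; have uC := shift_bigT_unitmx w0 sC.
have uD := shift_bigD_unitmx w0 sD.
rewrite !invmx_precond// /precond_term.
have -> : bigK (T - C) = (w%:M + bigT T) - (w%:M + bigT C).
  by rewrite !bigTE -bigK_sub !addrA opprD [RHS]addrACA subrr add0r.
rewrite mulmxBl mulKVmx// mulmxBr mulKmx// mulmxBr.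
by rewrite -!scalemxAl -!scalemxAr !mulmxA [RHS]addrC subrK.
Qed.

(** All factors other than [bigK L] are invertible, including [bigR T D], which is the identity plus
    a skew matrix. *)
Lemma rank_precond_term w T C D L : 0 < w -> T^T = T -> C^T = C -> D^T = D ->
  \rank (precond_term w T C D L) = (\rank L + \rank L)%N.
Proof.
move=> w0 sT sC sD; rewrite /precond_term.
have uD := shift_bigD_unitmx w0 sD; have uC := shift_bigT_unitmx w0 sC.
have uT := shift_bigT_unitmx w0 sT.
have full (A B : 'M[R]_(n + n)) : A \in unitmx -> \rank (A *m B) = \rank B.
  by move=> uA; rewrite eqmxMfull ?row_full_unit.
rewrite full ?unitmx_inv// full ?unitmx_inv// mxrankMfree ?rank_bigK//.
rewrite row_free_unit unitmx_mul unitmx_inv uT/= unitmxZ; last first.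
  by rewrite unitfE gt_eqF//; lra.
rewrite bigRE scalar_add_skew_unitmx ?oner_eq0// tr_bigK//.
by rewrite linearB/= sT sD.
Qed.

(** The factors are peeled off from the right: the half step costs [4 (w^2 + nu2)], [bigK L] costs
    [l2], and the inverses with [C] and [D] gain [(w + 1)^2 + c2] and [w^2]. *)
Lemma sqn_precond_term_le w (nu2 l2 c2 : R) T C D L x : 0 < w ->
  T^T = T -> C^T = C -> D^T = D -> 0 <= l2 -> 0 <= c2 ->
  (forall v, sqn (D *m v) <= nu2 * sqn v) ->
  (forall v, sqn (L *m v) <= l2 * sqn v) ->
  (forall v, c2 * sqn v <= sqn (C *m v)) ->
  w ^+ 2 * ((w + 1) ^+ 2 + c2) * sqn (precond_term w T C D L *m x)
    <= l2 * (4 * (w ^+ 2 + nu2)) * sqn x.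
Proof.
move=> w0 sT sC sD l0 c0 hD hL hC.
have uD := shift_bigD_unitmx w0 sD; have uC := shift_bigT_unitmx w0 sC.
have h1 := sqn_half_step_le x w0 sT sD hD.
have -> : precond_term w T C D L *m x =
  invmx (w%:M + bigD D) *m (invmx (w%:M + bigT C) *m
    (bigK L *m (invmx (w%:M + bigT T) *m ((2 * w) *: (bigR T D *m x))))).
  by rewrite /precond_term -!mulmxA scalemxAl.
move: (invmx (w%:M + bigT T) *m _) h1 => y h1.
have h2 : sqn (bigK L *m y) <= l2 * sqn y by exact: sqn_bigK_le.
move: (bigK L *m y) h2 => z h2.
have h3 : ((w + 1) ^+ 2 + c2) * sqn (invmx (w%:M + bigT C) *m z) <= sqn z.
  have e : z = (w%:M + bigT C) *m (invmx (w%:M + bigT C) *m z) by rewrite mulKVmx.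
  rewrite {2}e; move: (invmx _ *m z) => g.
  rewrite shift_bigT sqn_scalar_add_skew ?tr_bigK// mulrDl lerD2l.
  exact: sqn_bigK_ge.
move: (invmx (w%:M + bigT C) *m z) h3 => g h3.
have h4 : w ^+ 2 * sqn (invmx (w%:M + bigD D) *m g) <= sqn g.
  have e : g = (w%:M + bigD D) *m (invmx (w%:M + bigD D) *m g) by rewrite mulKVmx.
  rewrite {2}e; move: (invmx _ *m g) => f.
  by rewrite sqn_shift_bigD// lerDl sqn_ge0.
have k0 : 0 <= (w + 1) ^+ 2 + c2 by rewrite addr_ge0// sqr_ge0.
have h5 := ler_wpM2l k0 h4; have h6 := ler_wpM2l l0 h1.
rewrite mulrAC mulrC mulrCA; lra.
Qed.
End Preconditioners.

(** * Toeplitz matrices *)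

Section Toeplitz.
Variable R : realType.
Implicit Types (f g : nat -> R).

(** The distance [|i - j|]: truncated subtraction makes one summand zero. *)
Definition ndist (i j : nat) : nat := (i - j + (j - i))%N.

Definition toep M f : 'M[R]_M := \matrix_(i, j) f (ndist i j).

Lemma ndistC i j : ndist i j = ndist j i.
Proof. by rewrite /ndist addnC. Qed.

Lemma tr_toep M f : (toep M f)^T = toep M f.
Proof. by apply/matrixP => i j; rewrite !mxE ndistC. Qed.

Lemma sum_ndist M f (i : nat) : (i < M)%N ->
  \sum_(j < M) f (ndist i j) =
  \sum_(1 <= k < i.+1) f k + \sum_(0 <= k < M - i) f k.
Proof.
move=> iM; rewrite -(big_mkord xpredT (fun j => f (ndist i j))).
rewrite (big_cat_nat _ (n := i))//=; last exact: ltnW.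
congr (_ + _).
  rewrite big_nat_rev/= big_add1/=; apply: eq_big_nat => k /andP[_ ki].
  by congr f; rewrite /ndist; lia.
rewrite -{1}[i]add0n big_addn; apply: eq_big_nat => k _.
by congr f; rewrite /ndist; lia.
Qed.

(** A row index lies in one half of the range, so distances of at least [M / 2] occur on one side of
    it only, each at most once. *)
Lemma sum_ndist_far M f (i : nat) : ~~ odd M -> (i < M)%N -> (forall k, 0 <= f k) ->
  (forall k, (k < M./2)%N -> f k = 0) ->
  \sum_(j < M) f (ndist i j) <= \sum_(M./2 <= k < M) f k.
Proof.
move=> evM iM f0 fs; rewrite sum_ndist//.
have bound n : (n <= M)%N -> \sum_(0 <= k < n) f k <= \sum_(M./2 <= k < M) f k.
  move=> nM; apply: (@le_trans _ _ (\sum_(0 <= k < M) f k)).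
    by rewrite [leRHS](big_cat_nat _ (n := n))//= lerDl sumr_ge0.
  rewrite (big_cat_nat _ (n := M./2))//=; last by lia.
  by rewrite big_nat big1 ?add0r// => k /andP[_ /fs].
have [h|h] := leqP M./2 i.
  rewrite [X in _ + X]big_nat [X in _ + X]big1 ?addr0; last first.
    by move=> k /andP[_ kM]; apply: fs; lia.
  apply: le_trans (bound i.+1 iM).
  by rewrite [leRHS]big_ltn// lerDr.
rewrite [X in X + _]big_nat [X in X + _]big1 ?add0r; last first.
  by move=> k /andP[_ kM]; apply: fs; lia.
by apply: bound; lia.
Qed.

(** Each entry of the product is at most the absolute row sum times the Euclidean norm of [v];
    adding the [M] squared entries gives the factor [M]. *)
Lemma sqn_toep_le M f (v : 'cV[R]_M) : ~~ odd M ->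
  (forall k, (k < M./2)%N -> f k = 0) ->
  sqn (toep M f *m v) <=
    M%:R * (\sum_(M./2 <= k < M) `|f k|) ^+ 2 * sqn v.
Proof.
move=> evM fs; set s := \sum_(_ <= _ < _) _.
have s0 : 0 <= s by apply: sumr_ge0.
rewrite -[M in M%:R]card_ord -sumr_const -mulrA mulr_suml; apply: ler_sum => i _.
rewrite mul1r mxE -[leLHS]real_normK ?num_real//.
rewrite -[sqn v]sqr_sqrtr ?sqn_ge0// -exprMn lerXn2r ?nnegrE ?mulr_ge0 ?sqrtr_ge0//.
apply: (le_trans (ler_norm_sum _ _ _)).
apply: (@le_trans _ _ (\sum_(j < M) `|f (ndist i j)| * Num.sqrt (sqn v))).
  apply: ler_sum => j _; rewrite mxE normrM ler_wpM2l//.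
  rewrite -sqrtr_sqr ler_wsqrtr// /sqn (bigD1 j)//= lerDl.
  by apply: sumr_ge0 => k _; exact: sqr_ge0.
rewrite -mulr_suml ler_wpM2r ?sqrtr_ge0//.
apply: (@sum_ndist_far M (fun k => `|f k|)) => // k kM.
by rewrite fs// normr0.
Qed.

(* Row sums equal to [r] turn the quadratic form of [C] into
   [r |v|^2 - 1/2 sum_ij C_ij (v_i - v_j)^2]. *)
Lemma form_ge_row_sum M (C : 'M[R]_M) (r : R) (v : 'cV[R]_M) :
  C^T = C -> (forall i j, i != j -> C i j <= 0) ->
  (forall i, \sum_j C i j = r) ->
  r * sqn v <= (v^T *m (C *m v)) 0 0.
Proof.
move=> sC Cn Cr.
have -> : (v^T *m (C *m v)) 0 0 = \sum_i \sum_j C i j * (v i 0 * v j 0).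
  rewrite mxE; apply: eq_bigr => i _; rewrite !mxE mulr_sumr.
  by apply: eq_bigr => j _; ring.
have e1 : r * sqn v = \sum_i \sum_j C i j * v i 0 ^+ 2.
  by rewrite mulr_sumr; apply: eq_bigr => i _; rewrite -mulr_suml Cr.
have e2 : r * sqn v = \sum_i \sum_j C i j * v j 0 ^+ 2.
  rewrite exchange_big/= mulr_sumr; apply: eq_bigr => j _.
  rewrite -mulr_suml -(Cr j); congr (_ * _); apply: eq_bigr => i _.
  by rewrite -[in LHS]sC mxE.
set Q := \sum_i \sum_j _.
have e3 : Q + Q - (r * sqn v + r * sqn v) =
    \sum_i \sum_j - C i j * (v i 0 - v j 0) ^+ 2.
  rewrite {1}e1 e2 /Q -!big_split -sumrB; apply: eq_bigr => i _ /=.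
  by rewrite -!big_split -sumrB; apply: eq_bigr => j _ /=; ring.
have : 0 <= \sum_i \sum_j - C i j * (v i 0 - v j 0) ^+ 2.
  apply: sumr_ge0 => i _; apply: sumr_ge0 => j _.
  have [->|ij] := eqVneq i j; first by rewrite subrr expr0n mulr0.
  by rewrite mulr_ge0 ?sqr_ge0// oppr_ge0 Cn.
rewrite -e3; lra.
Qed.

(** Expanding [0 <= |C v - r v|^2] and using the lower bound on the quadratic form. *)
Lemma sqn_ge_row_sum M (C : 'M[R]_M) (r : R) (v : 'cV[R]_M) : 0 <= r ->
  C^T = C -> (forall i j, i != j -> C i j <= 0) ->
  (forall i, \sum_j C i j = r) ->
  r ^+ 2 * sqn v <= sqn (C *m v).
Proof.
move=> r0 sC Cn Cr; have h := form_ge_row_sum v sC Cn Cr.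
have := sqn_ge0 (- (r *: v) + C *m v).
rewrite sqn_add sqnN sqnZ -scaleNr linearZ/= -scalemxAl [X in 2 * X]mxE.
by nra.
Qed.

(** * Rank of a Toeplitz matrix supported in two corners *)

Section CornerRank.
Variables (M K : nat) (f : nat -> R).
Hypotheses (KM : (K.*2 <= M)%N) (fs : forall k, (k < M - K)%N -> f k = 0).
Hypothesis fK : f (M - K)%N != 0.

(** Substitution in two triangles with diagonal entry [f (M - K)]: column [i + (M - K)] isolates
    [u_i] for the first [K] indices, going upwards, and column [i - (M - K)] for the last [K], going
    downwards from [M - 1]. *)
Lemma toep_corner_ker (u : 'rV[R]_M) : u *m toep M f = 0 ->
  forall i : 'I_M, (i < K)%N || (M - K <= i)%N -> u 0 i = 0.
Proof.
move=> uL.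
have col (j i0 : nat) (i0M : (i0 < M)%N) : (j < M)%N ->
    (forall i : 'I_M, i != i0 :> nat -> u 0 i * f (ndist i j) = 0) ->
    f (ndist i0 j) != 0 -> u 0 (Ordinal i0M) = 0.
  move=> jM z nz; have := congr1 (fun B : 'M[R]_(1, M) => B 0 (Ordinal jM)) uL.
  rewrite !mxE (bigD1 (Ordinal i0M))//= big1 ?addr0 => [|i ii0].
    by rewrite mxE/= => /eqP; rewrite mulf_eq0 (negPf nz) orbF => /eqP.
  by rewrite mxE/= z.
have low n (i : 'I_M) : val i = n -> (i < K)%N -> u 0 i = 0.
  elim/ltn_ind: n i => n IHn [i iM] /= ni iK.
  apply: (col (i + (M - K))%N); first by lia.
    move=> k ki; have [ki'|ki'] := ltnP k i.
      by rewrite (IHn k) ?mul0r//; lia.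
    by rewrite fs ?mulr0// /ndist; have := ltn_ord k; lia.
  by have -> : ndist i (i + (M - K)) = (M - K)%N by rewrite /ndist; lia.
have high n (i : 'I_M) : (M - i = n)%N -> (M - K <= i)%N -> u 0 i = 0.
  elim/ltn_ind: n i => n IHn [i iM] /= ni iK.
  apply: (col (i - (M - K))%N); first by lia.
    move=> k ki; have [ki'|ki'] := ltnP i k.
      by rewrite (IHn (M - k)%N) ?mul0r//; lia.
    by rewrite fs ?mulr0// /ndist; have := ltn_ord k; lia.
  by have -> : ndist i (i - (M - K)) = (M - K)%N by rewrite /ndist; lia.
by move=> i /orP[|]; [exact: low|exact: high].
Qed.

Lemma mul_rowsub1 m (s : 'I_m -> 'I_M) (w : 'rV[R]_m) (i : 'I_m) :
  injective s -> (w *m rowsub s 1%:M) 0 (s i) = w 0 i.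
Proof.
move=> si; rewrite mxE (bigD1 i)//= big1 ?addr0 => [|k ki].
  by rewrite !mxE eqxx mulr1.
by rewrite !mxE (inj_eq si) (negPf ki) mulr0.
Qed.

(** The map [t] lists the [M - 2 K] middle rows, which vanish because no column is at distance
    [M - K] or more; [s] lists the first and last [K] rows, which are free by [toep_corner_ker]. *)
Lemma rank_toep_corner : \rank (toep M f) = K.*2.
Proof.
have s_lt (i : 'I_(K.*2)) : ((if (i < K)%N then (i : nat) else i + (M - K.*2)) < M)%N.
  by have := ltn_ord i; case: ifP; lia.
pose s (i : 'I_(K.*2)) := Ordinal (s_lt i).
have s_inj : injective s.
  move=> i j /(congr1 val)/= h; apply: ord_inj; move: h.
  by have := ltn_ord i; have := ltn_ord j; do 2 case: ifP; lia.
have t_lt (i : 'I_(M - K.*2)) : (i + K < M)%N by have := ltn_ord i; lia.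
pose t (i : 'I_(M - K.*2)) := Ordinal (t_lt i).
have t_inj : injective t.
  by move=> i j /(congr1 val)/= h; apply: ord_inj; lia.
apply/eqP; rewrite eqn_leq; apply/andP; split.
  have r : \rank (rowsub t 1%:M : 'M[R]_(_, M)) = (M - K.*2)%N.
    apply/eqP; apply: inj_row_free => w w0; apply/rowP => i.
    by rewrite -(mul_rowsub1 w i t_inj) w0 !mxE.
  have z : rowsub t 1%:M *m toep M f = 0.
    rewrite mul_rowsub_mx mul1mx; apply/matrixP => i j; rewrite !mxE fs//.
    by rewrite /= /ndist; have := ltn_ord i; have := ltn_ord j; lia.
  have := mulmx0_rank_max z; rewrite r; lia.
have : row_free (rowsub s 1%:M *m toep M f).
  apply: inj_row_free => w; rewrite mulmxA => w0; apply/rowP => i.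
  rewrite -(mul_rowsub1 w i s_inj) (toep_corner_ker w0) ?mxE//=.
  by have := ltn_ord i; case: ifP => //; lia.
rewrite -row_leq_rank => h; apply: leq_trans h _.
exact: mxrankM_maxr.
Qed.
End CornerRank.
End Toeplitz.

(** * The Strang splitting *)

Lemma sum_nat_reflect (V : nmodType) (F : nat -> V) (a b m : nat) : (b <= m)%N ->
  \sum_(a <= k < b) F k = \sum_(m.+1 - b <= k < m.+1 - a) F (m - k)%N.
Proof.
move=> bm; rewrite -{1}[a]add0n big_addn -{1}[(m.+1 - b)%N]add0n big_addn.
have -> : (m.+1 - a - (m.+1 - b) = b - a)%N by lia.
rewrite big_nat_rev/=; apply: eq_big_nat => k kb.
by congr F; lia.
Qed.

Section StrangSplitting.
Variables (R : realType) (alpha mu : R) (M : nat).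

Definition strang_err (k : nat) : R := cc alpha k%:Z - strang_s alpha M k.

Lemma Tmat_toep : Tmat alpha mu M = toep M (fun k => mu * cc alpha k%:Z).
Proof.
apply/matrixP => i j; rewrite !mxE cc_abs; congr (_ * cc _ _%:Z).
by rewrite /ndist; lia.
Qed.

Lemma strang_sym k : ~~ odd M ->
  (0 < k < M)%N -> strang_s alpha M (M - k) = strang_s alpha M k.
Proof.
move=> evM kM; rewrite /strang_s.
have [h|h|h] := ltngtP k M./2.
- have -> : (M - k < M./2)%N = false by lia.
  have -> : (M - k == M./2)%N = false by lia.
  by congr (cc _ _%:Z); lia.
- by have -> : (M - k < M./2)%N by lia.
- have -> : (M - k < M./2)%N = false by lia.
  by have -> : (M - k == M./2)%N by lia.
Qed.

(** Above the diagonal the cyclic index is [M - (j - i)], and the symmetry of the Strang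
    coefficients turns it into [j - i]. *)
Lemma Cmat_toep : ~~ odd M ->
  Cmat alpha mu M = toep M (fun k => mu * strang_s alpha M k).
Proof.
move=> evM.
apply/matrixP => i j; rewrite !mxE; congr (_ * _).
have iM := ltn_ord i; have jM := ltn_ord j.
have [ij|ij] := leqP j i.
  have -> : ndist i j = (i - j)%N by rewrite /ndist; lia.
  have -> : (i + M - j = (i - j) + M)%N by lia.
  by rewrite modnDr modn_small//; lia.
rewrite modn_small; last by lia.
have -> : ndist i j = (j - i)%N by rewrite /ndist; lia.
rewrite -[RHS]strang_sym//; last by lia.
by congr strang_s; lia.
Qed.

Lemma sub_TC_toep : ~~ odd M ->
  Tmat alpha mu M - Cmat alpha mu M = toep M (fun k => mu * strang_err k).
Proof.
move=> evM.
by rewrite Tmat_toep Cmat_toep//; apply/matrixP => i j; rewrite !mxE -mulrBr.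
Qed.

Lemma strang_err_near k : (k < M./2)%N -> strang_err k = 0.
Proof. by move=> h; rewrite /strang_err /strang_s h subrr. Qed.

(** At [k = M / 2] the error is [c_k] itself, since the Strang coefficient is [0] there; beyond, it
    is [t_(M-k) - t_k], positive by monotonicity. *)
Lemma strang_err_far k : 0 < alpha < 2 -> ~~ odd M ->
  (M./2 <= k < M)%N ->
  strang_err k != 0 /\ `|strang_err k| <= tcoef alpha (M - k).
Proof.
move=> a02 evM /andP[h kM]; rewrite /strang_err /strang_s ltnNge h/=.
have tk : 0 < tcoef alpha k by apply: tcoef_gt0 => //; lia.
have [e|ne] := eqVneq k M./2.
  have -> : (M - k = k)%N by lia.
  move: tk; rewrite subr0 /tcoef oppr_gt0 => tk.
  by rewrite ltr0_neq0// ltr0_norm.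
have : tcoef alpha k < tcoef alpha (M - k) by apply: tcoef_decr => //; lia.
have -> : cc alpha k%:Z - cc alpha (M - k)%N%:Z = tcoef alpha (M - k) - tcoef alpha k.
  by rewrite /tcoef opprK addrC.
move=> lt; rewrite gt_eqF ?subr_gt0// ger0_norm ?subr_ge0 ?(ltW lt)//.
by split=> //; rewrite gerBl ltW.
Qed.

(** The sum is [c_0] minus twice the [t_k] with [1 <= k < M / 2]; since [c_0 = 2 u_1 / alpha],
    telescoping leaves only [u_(M/2)]. *)
Lemma sum_strang_s : 0 < alpha < 2 -> (1 < M)%N -> ~~ odd M ->
  \sum_(0 <= k < M) strang_s alpha M k = 2 * (ucoef alpha M./2 / alpha).
Proof.
move=> a02 M1 evM.
have /andP[a0 _] := a02.
rewrite (big_cat_nat _ (n := M./2))//=; last by lia.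
rewrite [X in _ + X]big_ltn; last by lia.
rewrite {2}/strang_s ltnn eqxx add0r.
have -> : \sum_(0 <= k < M./2) strang_s alpha M k =
   cc alpha 0 - \sum_(1 <= k < M./2) tcoef alpha k.
  rewrite big_ltn; last by lia.
  rewrite {1}/strang_s ifT; last by lia.
  rewrite -sumrN; congr (_ + _); apply: eq_big_nat => k /andP[_ h].
  by rewrite /strang_s h /tcoef opprK.
have -> : \sum_(M./2.+1 <= k < M) strang_s alpha M k =
   - \sum_(1 <= k < M./2) tcoef alpha k.
  rewrite (@sum_nat_reflect _ _ _ _ M)// -sumrN.
  have -> : (M.+1 - M = 1)%N by lia.
  have -> : (M.+1 - M./2.+1 = M./2)%N by lia.
  apply: eq_big_nat => k kM; rewrite strang_sym//; last by lia.
  by rewrite /strang_s ifT ?opprK//; lia.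
rewrite sum_tcoef//; last by lia.
by rewrite ucoef1//; field; rewrite gt_eqF.
Qed.

Lemma sum_ndist_strang (i : nat) : 0 < alpha < 2 -> (1 < M)%N -> ~~ odd M ->
  (i < M)%N ->
  \sum_(j < M) strang_s alpha M (ndist i j) = 2 * (ucoef alpha M./2 / alpha).
Proof.
move=> a02 M1 evM iM; rewrite sum_ndist// -sum_strang_s//.
rewrite [RHS](big_cat_nat _ (n := (M - i)%N))//=; last by lia.
rewrite addrC; congr (_ + _); rewrite [RHS](@sum_nat_reflect _ _ _ _ M)//.
have -> : (M.+1 - M = 1)%N by lia.
have -> : (M.+1 - (M - i) = i.+1)%N by lia.
by apply: eq_big_nat => k kM; rewrite strang_sym//; lia.
Qed.

Lemma strang_s_le0 k : 0 < alpha < 2 ->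
  (0 < k < M)%N -> strang_s alpha M k <= 0.
Proof.
move=> a02 kM; rewrite /strang_s.
have tn j : (0 < j)%N -> cc alpha j%:Z <= 0.
  by move=> j0; have := @tcoef_gt0 R alpha j a02 j0; rewrite /tcoef; lra.
by case: ifP => _; [|case: ifP => // _]; apply: tn; lia.
Qed.

Lemma sqn_Cmat_ge (c : R) (v : 'cV[R]_M) : 0 < alpha < 2 -> 0 < mu -> (1 < M)%N -> ~~ odd M ->
  0 <= c -> c <= mu * (2 * (ucoef alpha M./2 / alpha)) ->
  c ^+ 2 * sqn v <= sqn (Cmat alpha mu M *m v).
Proof.
move=> a02 mu0 M1 evM c0 cle; rewrite Cmat_toep//.
apply: (@le_trans _ _ ((mu * (2 * (ucoef alpha M./2 / alpha))) ^+ 2 * sqn v)).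
  by rewrite ler_wpM2r ?sqn_ge0// lerXn2r ?nnegrE// (le_trans c0).
apply: sqn_ge_row_sum; first exact: le_trans c0 cle.
- exact: tr_toep.
- move=> i j ij; rewrite mxE pmulr_rle0//; apply: strang_s_le0 => //.
  have : (i : nat) != j by apply: contra ij => /eqP/val_inj ->.
  by have := ltn_ord i; have := ltn_ord j; rewrite /ndist; lia.
- move=> i; rewrite -(sum_ndist_strang a02 M1 evM (ltn_ord i)) mulr_sumr.
  by apply: eq_bigr => j _; rewrite mxE.
Qed.

Variable K : nat.

Definition corner_sym (k : nat) : R := if (M - K <= k)%N then mu * strang_err k else 0.
Definition rest_sym (k : nat) : R := if (M - K <= k)%N then 0 else mu * strang_err k.

Lemma toep_corner_rest : ~~ odd M ->
  Tmat alpha mu M - Cmat alpha mu M = toep M corner_sym + toep M rest_sym.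
Proof.
move=> evM.
rewrite sub_TC_toep//; apply/matrixP => i j; rewrite !mxE /corner_sym /rest_sym.
by case: ifP; rewrite ?addr0 ?add0r.
Qed.

Lemma rank_corner : 0 < alpha < 2 -> 0 < mu -> ~~ odd M -> (0 < K)%N -> (K <= M./2)%N ->
  \rank (toep M corner_sym) = K.*2.
Proof.
move=> a02 mu0 evM K0 KM.
apply: rank_toep_corner; first by lia.
  by move=> k h; rewrite /corner_sym leqNgt h.
rewrite /corner_sym leqnn mulf_neq0 ?(gt_eqF mu0)//.
by case: (@strang_err_far (M - K) a02 evM) => //; lia.
Qed.

Lemma corner_sym_near k : (k < M./2)%N -> corner_sym k = 0.
Proof. by move=> h; rewrite /corner_sym strang_err_near// mulr0 if_same. Qed.

Lemma rest_sym_near k : (k < M./2)%N -> rest_sym k = 0.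
Proof. by move=> h; rewrite /rest_sym strang_err_near// mulr0 if_same. Qed.

(** Reflection [k -> M - k] replaces the errors by the majorants [t_k], whose sum telescopes. *)
Lemma sum_strang_err_le (p q : nat) : 0 < alpha < 2 -> 0 < mu -> ~~ odd M ->
  (M./2 <= p)%N -> (p <= q <= M)%N ->
  \sum_(p <= k < q) `|mu * strang_err k| <=
  mu * ((ucoef alpha (M.+1 - q) - ucoef alpha (M.+1 - p)) / alpha).
Proof.
move=> a02 mu0 evM mp pq; rewrite -sum_tcoef//; last by lia.
rewrite mulr_sumr (@sum_nat_reflect _ _ _ _ M); last by lia.
apply: ler_sum_nat => k kM; rewrite normrM gtr0_norm// ler_pM2l//.
case: (@strang_err_far (M - k) a02 evM) => [|_]; first by lia.
by have -> : (M - (M - k) = k)%N by lia.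
Qed.

Lemma sum_corner_sym_le : 0 < alpha < 2 -> 0 < mu -> ~~ odd M -> (K <= M./2)%N ->
  \sum_(M./2 <= k < M) `|corner_sym k| <=
  mu * (cc alpha 0 / 2 - ucoef alpha K.+1 / alpha).
Proof.
move=> a02 mu0 evM KM.
have /andP[a0 _] := a02.
rewrite (big_cat_nat _ (n := (M - K)%N))//=; [|lia..].
rewrite big_nat big1 ?add0r => [|k /andP[_ h]]; last first.
  by rewrite /corner_sym leqNgt h normr0.
rewrite (eq_big_nat _ _ (F2 := fun k => `|mu * strang_err k|)); last first.
  by move=> k /andP[h _]; rewrite /corner_sym h.
apply: le_trans (sum_strang_err_le a02 mu0 evM _ _) _; [lia..|].
have -> : (M.+1 - M = 1)%N by lia.
have -> : (M.+1 - (M - K) = K.+1)%N by lia.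
rewrite ler_pM2l// ucoef1// le_eqVlt; apply/orP; left; apply/eqP.
by field; rewrite gt_eqF.
Qed.

Lemma sum_rest_sym_le : 0 < alpha < 2 -> 0 < mu -> ~~ odd M -> (K <= M./2)%N ->
  \sum_(M./2 <= k < M) `|rest_sym k| <=
  mu * (ucoef alpha K.+1 / alpha).
Proof.
move=> a02 mu0 evM KM.
have /andP[a0 _] := a02.
rewrite (big_cat_nat _ (n := (M - K)%N))//=; [|lia..].
rewrite [X in _ + X]big_nat [X in _ + X]big1 ?addr0 => [|k /andP[h _]]; last first.
  by rewrite /rest_sym h normr0.
rewrite (eq_big_nat _ _ (F2 := fun k => `|mu * strang_err k|)); last first.
  by move=> k /andP[_ h]; rewrite /rest_sym leqNgt h.
apply: le_trans (sum_strang_err_le a02 mu0 evM _ _) _; [lia..|].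
have -> : (M.+1 - (M - K) = K.+1)%N by lia.
rewrite ler_pM2l// ler_pM2r ?invr_gt0// gerBl ltW// ucoef_gt0//; lia.
Qed.
End StrangSplitting.

(** * From squared estimates to the operator norm *)

Section OperatorNorm.
Variable R : realType.

Lemma opnorm2_le m n (A : 'M[R]_(m, n)) (B : R) : 0 <= B ->
  (forall x, sqn (A *m x) <= B ^+ 2 * sqn x) -> opnorm2 A <= B.
Proof.
move=> B0 h; apply: ge_sup.
  exists (vnorm2 (A *m 0)); exists 0 => //=.
  rewrite /vnorm2 big1 ?sqrtr0// => i _; by rewrite mxE expr0n.
move=> _ [x /= x1 <-].
have s1 : sqn x <= 1.
  rewrite -[sqn x]sqr_sqrtr ?sqn_ge0// expr_le1// ?sqrtr_ge0//.
rewrite -(ger0_norm B0) -sqrtr_sqr; apply: ler_wsqrtr.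
by apply: (le_trans (h x)); rewrite ler_piMr// sqr_ge0.
Qed.

Lemma sqn_Dmat_le M (d : 'I_M -> R) (v : 'cV[R]_M) : (forall j, 0 <= d j) ->
  sqn (Dmat d *m v) <= (\big[Num.max/0]_(j < M) d j) ^+ 2 * sqn v.
Proof.
move=> d0; rewrite mulr_sumr; apply: ler_sum => i _.
rewrite mul_diag_mx !mxE exprMn ler_wpM2r ?sqr_ge0//.
have h : d i <= \big[Num.max/0]_(j < M) d j by exact: le_bigmax.
by rewrite lerXn2r ?nnegrE// (le_trans (d0 i)).
Qed.

Lemma tr_Dmat M (d : 'I_M -> R) : (Dmat d)^T = Dmat d.
Proof. exact: tr_diag_mx. Qed.

Lemma opnorm2_precond_term_le M (w nu c s : R) (f : nat -> R)
  (T C D : 'M[R]_M) : 0 < w -> ~~ odd M ->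
  T^T = T -> C^T = C -> D^T = D -> 0 <= s ->
  (forall v, sqn (D *m v) <= nu ^+ 2 * sqn v) ->
  (forall v, c ^+ 2 * sqn v <= sqn (C *m v)) ->
  (forall k, (k < M./2)%N -> f k = 0) ->
  \sum_(M./2 <= k < M) `|f k| <= s ->
  opnorm2 (precond_term w T C D (toep M f)) <=
  2 * (w ^+ 2 + nu ^+ 2) * Num.sqrt M%:R
    / (w ^+ 2 * Num.sqrt ((w + 1) ^+ 2 + c ^+ 2)) * s.
Proof.
move=> w0 evM sT sC sD s0 hD hC fs fle.
set r := (w + 1) ^+ 2 + c ^+ 2.
have r0 : 0 < r by rewrite ltr_pwDl ?sqr_ge0// exprn_gt0//; lra.
have w2 : 0 < w ^+ 2 by rewrite exprn_gt0.
have n2 : 0 <= nu ^+ 2 by rewrite sqr_ge0.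
apply: opnorm2_le => [|x].
  rewrite mulr_ge0// divr_ge0 ?mulr_ge0 ?sqrtr_ge0//; lra.
have hL v : sqn (toep M f *m v) <= M%:R * s ^+ 2 * sqn v.
  apply: (le_trans (sqn_toep_le v evM fs)); rewrite ler_wpM2r ?sqn_ge0//.
  by rewrite ler_wpM2l// lerXn2r ?nnegrE// sumr_ge0.
have l0 : 0 <= M%:R * s ^+ 2 by rewrite mulr_ge0// sqr_ge0.
have := sqn_precond_term_le x w0 sT sC sD l0 (sqr_ge0 c) hD hL hC.
rewrite -/r => h.
have rw : 0 < w ^+ 2 * r by rewrite mulr_gt0.
rewrite -(ler_pM2l rw); apply: (le_trans h).
have x0 := sqn_ge0 x.
rewrite [leRHS]mulrA ler_wpM2r//.
rewrite !exprMn exprVn !exprMn !sqr_sqrtr ?(ltW r0)// ?ler0n//.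
set a := w ^+ 2 in w2 n2 rw *; set n := nu ^+ 2 in n2 *.
rewrite [leRHS](_ : _ = M%:R * s ^+ 2 * (4 * ((a + n) ^+ 2 / a))); last first.
  by field; rewrite !gt_eqF.
(* The squared target exceeds the available bound by the factor [(a + n) / a], so only [a <= a + n]
   remains. *)
rewrite ler_wpM2l// ler_pM2l// ler_pdivlMr// expr2 ler_wpM2l//; lra.
Qed.
End OperatorNorm.

(** * Size of the truncation order *)

Section Truncation.
Variable R : realType.
Implicit Types alpha x : R.

Lemma ltr_powR_pos alpha (x y : R) : 0 < alpha -> 0 <= x -> x < y ->
  x `^ alpha < y `^ alpha.
Proof.
move=> a0 x0 xy.
by apply: (@gt0_ltr_powR R alpha a0) => //; rewrite nnegrE // (le_trans x0) // ltW.
Qed.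

Lemma ler_powR_pos alpha (x y : R) : 0 < alpha -> 0 <= x -> x <= y ->
  x `^ alpha <= y `^ alpha.
Proof.
move=> a0 x0 xy.
apply: (@ge0_ler_powR R alpha (ltW a0)) => //; rewrite nnegrE //.
exact: le_trans xy.
Qed.

(* [q] stands for [mu theta0 / eps] and the first hypothesis on [eps] reads
   [q < ((M - 2) / 2) ^ alpha]. *)
Lemma truncation_order alpha (q : R) (M : nat) : 0 < alpha -> (8 <= M)%N ->
  ~~ odd M -> 1 <= q -> q < ((M%:R - 2) / 2) `^ alpha ->
  exists K : nat, [/\ (2 <= K <= M./2)%N,
    Num.ceil (q `^ alpha^-1) + 1 = K%:Z & q <= (K%:R - 1) `^ alpha].
Proof.
move=> a0 M8 evM q1 qM.
have q0 : 0 <= q by lra.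
have an : alpha != 0 by rewrite gt_eqF.
set p := q `^ alpha^-1.
have pq : p `^ alpha = q by rewrite /p -powRrM mulVf// powRr1.
have p0 : 0 <= p by rewrite powR_ge0.
have p1 : 1 <= p.
  have ai : 0 < alpha^-1 by rewrite invr_gt0.
  by have := ler_powR_pos ai ler01 q1; rewrite powR1.
have m0 : 0 <= (M%:R - 2) / 2 :> R.
  have : (8 : R) <= M%:R by rewrite ler_nat.
  lra.
have pM : p < (M%:R - 2) / 2.
  rewrite ltNge; apply/negP => h.
  by have := ler_powR_pos a0 m0 h; rewrite pq leNgt qM.
(* For even [M] the strict upper bound on [p] is an integer, so it also bounds the ceiling, and
   [K <= M / 2]. *)
have eM : (M%:R - 2) / 2 = (M./2%:R - 1) :> R.
  have -> : M = (M./2).*2 by lia.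
  by rewrite doubleK -muln2 natrM; field.
rewrite eM in pM.
have c1 : (1 <= Num.ceil p)%R by rewrite -gtz0_ge1 ceil_gt0; lra.
have cM : (Num.ceil p <= M./2%:Z - 1)%R.
  by rewrite ceil_le_int intrB/= ltW.
set z := Num.ceil p + 1; have ze : z = `|z|%N%:Z by rewrite /z; lia.
exists `|z|%N; split => //; first by rewrite /z; lia.
have -> : `|z|%N%:R = z%:~R :> R by rewrite [in RHS]ze.
rewrite /z intrD addrK -[leLHS]pq; apply: ler_powR_pos => //.
exact: ceil_ge.
Qed.
End Truncation.

(** * Assembly of the splitting, its rank and its norm bounds *)

Theorem theorem4p4 (R : realType) (alpha gamma tau a b omega eps : R)
  (M : nat) (d : 'I_M -> R) :
  1 < alpha -> alpha < 2 -> 0 < gamma -> 0 < tau -> a < b ->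
  (8 <= M)%N -> ~~ odd M -> 0 < omega -> (forall j, 0 <= d j) ->
  let mu := mu_of alpha gamma tau a b M in
  let th := theta alpha in
  let th0 := theta0 alpha in
  2 `^ alpha * mu * th0 / (M%:R - 2) `^ alpha < eps ->
  eps <= mu * th0 ->
  let k0 : int := Num.ceil ((mu * th0 / eps) `^ alpha^-1) + 1 in
  let nu := \big[Num.max/0]_(j < M) d j in
  let T := Tmat alpha mu M in
  let C := Cmat alpha mu M in
  let D := Dmat d in
  let F := precond omega (bigT T) (bigD D) in
  let Ft := precond omega (bigT C) (bigD D) in
  let RR := bigR T D in
  let den := omega ^+ 2 * Num.sqrt ((omega + 1) ^+ 2
               + (2 `^ (alpha + 1) * gamma * tau * th / (b - a) `^ alpha) ^+ 2) in
  exists P Q : 'M[R]_(M + M),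
    invmx Ft *m RR = invmx F *m RR + P + Q /\
    (\rank P)%:Z = 4 * k0 /\
    opnorm2 P < 2 * (omega ^+ 2 + nu ^+ 2) * Num.sqrt M%:R * mu / den
                * (cc alpha 0 / 2 - th / (M%:R - 2^-1) `^ alpha) /\
    opnorm2 Q < 2 * (omega ^+ 2 + nu ^+ 2) * Num.sqrt M%:R * eps / den.
Proof.
move=> a1 a2 g0 t0 ab M8 evM w0 d0 mu th th0 eps_lb eps_ub k0 nu T C D F Ft RR den.
have al0 : 0 < alpha by lra.
have a02 : 0 < alpha < 2 by rewrite al0.
have thp : 0 < th := theta_gt0 a1 a2.
have th0p : 0 < th0 := theta0_gt0 a1 a2.
have thE : th = theta alpha by [].
have th0E : th0 = theta0 alpha by [].
have MR : (8 : R) <= M%:R by rewrite ler_nat.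
have ba : 0 < (b - a) `^ alpha by rewrite powR_gt0 ?subr_gt0.
have muE : mu = gamma * tau * (M%:R + 1) `^ alpha / (b - a) `^ alpha.
  have n0 : (0 : R) <= M%:R + 1 by lra.
  have e : (M%:R + 1)^-1 `^ alpha = ((M%:R + 1) `^ alpha)^-1 :> R.
    by rewrite -powR_inv1// -powRrM mulN1r powRN.
  rewrite /mu /mu_of /hh powRM ?invr_ge0 ?subr_ge0 ?(ltW ab)// e invfM invrK.
  by ring.
have mup : 0 < mu by rewrite muE divr_gt0// !mulr_gt0// powR_gt0; lra.
clearbody mu th th0.
have M2p : 0 < (M%:R - 2) `^ alpha by rewrite powR_gt0; lra.
have two : 0 < (2 : R) `^ alpha by rewrite powR_gt0.
have epsp : 0 < eps.
  by apply: lt_trans eps_lb; rewrite divr_gt0// !mulr_gt0.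
pose q := mu * th0 / eps.
have q1 : 1 <= q by rewrite /q ler_pdivlMr// mul1r.
have qM : q < ((M%:R - 2) / 2) `^ alpha.
  rewrite powRM; [|lra..].
  rewrite -(powR_inv1 (ler0n _ 2)) -powRrM mulN1r powRN.
  rewrite /q ltr_pdivrMr//; move: eps_lb; rewrite ltr_pdivrMr// => h.
  rewrite mulrAC ltr_pdivlMr//; lra.
have [K [/andP[K2 KM] kE qK]] := truncation_order al0 M8 evM q1 qM.
have K1p : 0 < (K%:R - 1) `^ alpha.
  by rewrite powR_gt0// subr_gt0 ltr1n.
set c := 2 `^ (alpha + 1) * gamma * tau * th / (b - a) `^ alpha in den *.
have c0 : 0 <= c by rewrite /c divr_ge0 ?(ltW ba)// !mulr_ge0 ?powR_ge0 ?ltW.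
have m3 : (3 <= M./2)%N by clear -M8; lia.
have m0 : (0 < M./2)%N by exact: leq_trans m3.
have M2 : (2 * M./2 <= M.+1)%N by clear; lia.
have KM2 : (K.+2 <= M)%N by clear -KM K2 M8; lia.
(* The right-hand side is the common row sum of [C]. The mesh [h = (b - a) / (M + 1)] puts
   [(M + 1)^alpha] into [mu], which dominates the power of [2 (M / 2)] left by the [theta] bound at
   [M / 2 >= 3]. *)
have cC : c <= mu * (2 * (ucoef alpha M./2 / alpha)).
  have hm := ucoef_ge_theta a1 a2 m3; rewrite -thE in hm.
  have mp : 0 < M./2%:R `^ alpha :> R by rewrite powR_gt0// ltr0n.
  have h2 : 2 `^ alpha * M./2%:R `^ alpha <= (M%:R + 1) `^ alpha :> R.
    rewrite -powRM//; apply: ler_powR_pos => //.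
    by rewrite -natrM natr1 ler_nat.
  have h3 : 0 < 2 * gamma * tau / (b - a) `^ alpha by rewrite divr_gt0// !mulr_gt0.
  have -> : c = 2 * gamma * tau / (b - a) `^ alpha * (2 `^ alpha * th).
    rewrite /c powRD; last by rewrite pnatr_eq0 implybT.
    by rewrite powRr1//; field; rewrite gt_eqF.
  have -> : mu * (2 * (ucoef alpha M./2 / alpha)) =
    2 * gamma * tau / (b - a) `^ alpha * ((M%:R + 1) `^ alpha * (ucoef alpha M./2 / alpha)).
    by rewrite muE; field; rewrite !gt_eqF.
  rewrite ler_pM2l//.
  apply: (@le_trans _ _ (2 `^ alpha * M./2%:R `^ alpha * (th / M./2%:R `^ alpha))).
    by rewrite le_eqVlt; apply/orP; left; apply/eqP; field; rewrite gt_eqF.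
  by rewrite ler_pM ?divr_ge0 ?mulr_ge0 ?powR_ge0 ?(ltW thp).
have K0 : (0 < K)%N by exact: leq_trans K2.
have sT : T^T = T by rewrite /T Tmat_toep// tr_toep.
have sC : C^T = C by rewrite /C Cmat_toep// tr_toep.
have sD : D^T = D by exact: tr_Dmat.
have hD v : sqn (D *m v) <= nu ^+ 2 * sqn v by exact: sqn_Dmat_le.
have hC v : c ^+ 2 * sqn v <= sqn (C *m v) by by apply: sqn_Cmat_ge => //; exact: leq_trans M8.
pose fP := corner_sym alpha mu M K; pose fQ := rest_sym alpha mu M K.
exists (precond_term omega T C D (toep M fP)).
exists (precond_term omega T C D (toep M fQ)).
have rp : 0 < Num.sqrt ((omega + 1) ^+ 2 + c ^+ 2).
  by rewrite sqrtr_gt0 ltr_pwDl ?sqr_ge0// exprn_gt0; lra.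
have denp : 0 < den by rewrite /den mulr_gt0// exprn_gt0.
have Bp : 0 < 2 * (omega ^+ 2 + nu ^+ 2) * Num.sqrt M%:R / den.
  rewrite divr_gt0// !mulr_gt0 ?sqrtr_gt0//; last by lra.
  by rewrite ltr_pwDl ?sqr_ge0// exprn_gt0.
have uKp : 0 < ucoef alpha K.+1 / alpha by rewrite divr_gt0// ucoef_gt0.
split; first by rewrite precond_diff// -addrA -precond_termD -toep_corner_rest.
(* The two corners give rank [2 K], which the skew block doubles to [4 K]. *)
split; first by rewrite rank_precond_term// rank_corner// /k0 -/q kE; clear; lia.
split.
  have hP := sum_corner_sym_le a02 mup evM KM.
  have s0 := le_trans (sumr_ge0 _ (fun k _ => normr_ge0 _)) hP.
  have h := opnorm2_precond_term_le w0 evM sT sC sD s0 hD hC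
    (@corner_sym_near R alpha mu M K) hP.
  rewrite -/den in h; apply: (le_lt_trans h).
  rewrite [ltRHS](_ : _ = 2 * (omega ^+ 2 + nu ^+ 2) * Num.sqrt M%:R / den *
    (mu * (cc alpha 0 / 2 - th / (M%:R - 2^-1) `^ alpha))); last first.
    by rewrite [_ * mu / den]mulrAC -[LHS]mulrA.
  rewrite ltr_pM2l// ltr_pM2l// ltrD2l ltrN2.
  have K3 : (3 <= K.+1)%N by [].
  (* Strictness comes from [K + 1 <= M - 1 < M - 1/2]. *)
  apply: lt_le_trans (ucoef_ge_theta a1 a2 K3); rewrite -thE.
  rewrite ltr_pM2l// ltf_pV2 ?posrE ?powR_gt0//; last by lra.
  apply: ltr_powR_pos => //.
  have : K.+2%:R <= M%:R :> R by rewrite ler_nat.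
  rewrite -(natr1 K.+1); lra.
have hQ := sum_rest_sym_le a02 mup evM KM.
have s0 := le_trans (sumr_ge0 _ (fun k _ => normr_ge0 _)) hQ.
have h := opnorm2_precond_term_le w0 evM sT sC sD s0 hD hC
  (@rest_sym_near R alpha mu M K) hQ.
rewrite -/den in h; apply: (le_lt_trans h).
rewrite [ltRHS](_ : _ = 2 * (omega ^+ 2 + nu ^+ 2) * Num.sqrt M%:R / den * eps); last first.
  by rewrite [LHS]mulrAC.
rewrite ltr_pM2l//.
(* The first inequality is the strict [theta0] bound at [n = K]; the second is the choice of [K],
   namely [mu theta0 / eps <= (K - 1)^alpha]. *)
apply: (@lt_le_trans _ _ (mu * (th0 / (K%:R - 1) `^ alpha))).
  by rewrite ltr_pM2l// th0E ucoef_lt_theta0.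
by move: qK; rewrite /q mulrA !ler_pdivrMr// [eps * _]mulrC.
Qed.
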